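(* The class of separable Banach spaces with an unconditional basis and not containing an isomorphic copy of $\ell_1$ is strongly bounded: for every analytic set $A\subseteq\mathrm{SB}$ of spaces with an unconditional basis not containing $\ell_1$, there exists a Banach space $Y$ with an unconditional basis, not containing $\ell_1$, that contains isomorphic copies of every $X\in A$.
   Context: Let $C(2^{\mathbb{N}})$ be the Banach space of continuous real functions on the Cantor set with the sup norm. $\mathrm{SB}$ denotes the set of closed linear subspaces of $C(2^{\mathbb{N}})$ with the Effros–Borel $\sigma$-algebra (generated by the sets $\{X: X\cap U\neq\varnothing\}$, $U\subseteq C(2^{\mathbb{N}})$ open), a standard Borel space; a subset of $\mathrm{SB}$ is analytic if it is analytic in this standard Borel space. A class $\mathcal{C}\subseteq\mathrm{SB}$ is called strongly bounded if for every analytic subset $A\subseteq\mathcal{C}$ there exists $Y\in\mathcal{C}$ that contains isomorphic copies of every $X\in A$. *)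

(* Defs.v *)
From HB Require Import structures.
From mathcomp Require Import all_boot all_order all_algebra.
From mathcomp Require Import all_classical all_reals all_analysis.

Set Implicit Arguments.
Unset Strict Implicit.
Unset Printing Implicit Defensive.

Import Order.TTheory GRing.Theory Num.Theory.
Local Open Scope classical_set_scope.
Local Open Scope ring_scope.

Section C2N.
Variable R : realType.

Definition fn := cantor_space -> R.

Definition supnorm (f : fn) : R := sup [set `|f t| | t in [set: cantor_space]].

Definition CC : set fn := [set f : fn | continuous (f : cantor_space -> R^o)].

Definition C_open (U : set fn) : Prop :=
  U `<=` CC /\
  forall f, U f -> exists2 e : R, 0 < e &
    forall g, CC g -> supnorm (fun t => g t - f t) < e -> U g.

Definition closed_subspace (X : set fn) : Prop :=
  [/\ X `<=` CC, X (fun _ => 0),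
      (forall (a : R) x y, X x -> X y -> X (fun t => a * x t + y t)) &
      (forall f, CC f ->
         (forall e : R, 0 < e -> exists2 g, X g & supnorm (fun t => f t - g t) < e) ->
         X f)].

Definition SB : set (set fn) := closed_subspace.

Definition effros_gen : set (set (set fn)) :=
  [set E | exists U, C_open U /\ E = [set X | SB X /\ X `&` U !=set0]].

Definition effros_borel : set (set (set fn)) := <<s SB, effros_gen>>.

Definition baire_gen : set (set (nat -> nat)) :=
  [set E | exists n k, E = [set al : nat -> nat | al n = k]].

Definition baire_borel : set (set (nat -> nat)) := <<s baire_gen>>.

Definition analytic_SB (A : set (set fn)) : Prop :=
  A `<=` SB /\
  (A = set0 \/
   exists f : (nat -> nat) -> set fn,
     [/\ (forall al, SB (f al)),
         (forall B, effros_borel B -> baire_borel (f @^-1` B)) &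
         range f = A]).

Definition embeds (X Y : set fn) : Prop :=
  exists T : fn -> fn,
    [/\ (forall x, X x -> Y (T x)),
        (forall (a : R) x y, X x -> X y ->
           T (fun t => a * x t + y t) = (fun t => a * T x t + T y t)) &
        exists c C : R, 0 < c /\
          forall x, X x -> c * supnorm x <= supnorm (T x) <= C * supnorm x].

Definition l1norm (a : nat -> R) : \bar R := (\sum_(0 <= n <oo) (`|a n|)%:E)%E.
Definition l1 : set (nat -> R) := [set a | (l1norm a < +oo)%E].

Definition contains_l1 (X : set fn) : Prop :=
  exists T : (nat -> R) -> fn,
    [/\ (forall a, l1 a -> X (T a)),
        (forall (r : R) a b, l1 a -> l1 b ->
           T (fun n => r * a n + b n) = (fun t => r * T a t + T b t)) &
        exists c C : R, 0 < c /\
          forall a, l1 a ->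
            c * fine (l1norm a) <= supnorm (T a) <= C * fine (l1norm a)].

Definition series_conv (x : fn) (e : nat -> fn) (a : nat -> R) : Prop :=
  forall eps : R, 0 < eps -> exists N0 : nat, forall N, (N0 <= N)%N ->
    supnorm (fun t => x t - \sum_(n < N) a n * e n t) < eps.

(* sum_n a_n e_n converges unconditionally to x (convergence of the net of
   finite partial sums) *)
Definition uncond_conv (x : fn) (e : nat -> fn) (a : nat -> R) : Prop :=
  forall eps : R, 0 < eps -> exists N0 : nat, forall s : seq nat, uniq s ->
    (forall n, (n < N0)%N -> n \in s) ->
    supnorm (fun t => x t - \sum_(n <- s) a n * e n t) < eps.

Definition has_uncond_basis (X : set fn) : Prop :=
  exists e : nat -> fn,
    (forall n, X (e n)) /\
    forall x, X x ->
      (exists! a : nat -> R, series_conv x e a) /\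
      (forall a, series_conv x e a -> uncond_conv x e a).

Definition unc_no_l1 : set (set fn) :=
  [set X | [/\ SB X, has_uncond_basis X & ~ contains_l1 X]].

End C2N.

(* Main.v *)
(* Each X in A has, up to isomorphism, a basic sequence taken from a fixed
   countable dense set D of C(2^N) as its basis. The sequences in D that are
   unconditional and sufficiently close to a sequence of elements of some member
   of A form a Suslin set (only finitely much information about f(alpha) is
   tested at a time, through sets {alpha : f(alpha) meets a ball}), hence are
   the first coordinates of the branches of a closed set, i.e. of a tree on
   N x N. Attach to every node of the tree the last function it codes and let Y
   be the space spanned by the functions
     g_n (chi, t) = [n in chi] d_n (t),  chi a chain of the tree, t in 2^N,
   that is, the norm is the supremum over chains of the norms of the restrictions.
   Restricting chi to a set of nodes projects onto the corresponding coordinates,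
   so (g_n) is an unconditional basis, and each branch spans an isomorphic copy
   of the space it codes.
   If Y contained l_1, there would be blocks v_j of (g_n) equivalent to the unit
   vector basis; by Simons' inequality, applied to the functions
   sum_n |v_j(n) g_n|, there is a single point (chi, t) at which infinitely many of
   them stay bounded below. Then chi determines a branch, and by unconditionality
   the restrictions of the blocks to it span l_1 in a member of A: contradiction. *)
From mathcomp Require Import all_boot all_order all_algebra.
From mathcomp Require Import all_classical all_reals all_analysis.
From mathcomp Require Import ring lra zify.
Require Import Defs.

Set Implicit Arguments.
Unset Strict Implicit.
Unset Printing Implicit Defensive.

Import Order.TTheory GRing.Theory Num.Theory.
Import numFieldNormedType.Exports.
Local Open Scope classical_set_scope.
Local Open Scope ring_scope.

(** * Continuous functions on the Cantor set *)

Definition agree (T : Type) (n : nat) (s t : nat -> T) :=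
  forall m, (m < n)%N -> s m = t m.

Lemma agreeW T m n (s t : nat -> T) : (m <= n)%N -> agree n s t -> agree m s t.
Proof. by move=> mn st k km; apply: st; apply: leq_trans mn. Qed.

Lemma agree_trans T n (s t u : nat -> T) :
  agree n s t -> agree n t u -> agree n s u.
Proof. by move=> st tu k kn; rewrite st// tu. Qed.

Section Cantor.
Variable R : realType.
Implicit Types (f g h : fn R) (t u : cantor_space) (e M : R).

Definition cyl_filter t : set_system cantor_space :=
  filter_from setT (fun n => [set s : cantor_space | agree n t s]).

Lemma cyl_filter_filter t : Filter (cyl_filter t).
Proof.
apply: filter_from_filter; first by exists 0%N.
move=> i j _ _; exists (maxn i j) => // s sij.
by split; apply: agreeW sij; [exact: leq_maxl|exact: leq_maxr].
Qed.

(** The topology is the product one, so convergence of the cylinder filter is tested one coordinate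
    at a time. Conversely, a cylinder of length [n.+1] is cut out of one of length [n] by a
    condition on a single digit, whence the induction. *)
Lemma nbhs_cantorP t (U : set cantor_space) :
  nbhs t U <-> exists n, forall s : cantor_space, agree n t s -> U s.
Proof.
split=> [tU|[n nU]].
  have F := cyl_filter_filter t.
  have : cyl_filter t --> t.
    apply/cvg_sup => i V [W [[W' oW' <-] W't] WV].
    apply: (filterS WV).
    by exists i.+1 => // s /(_ i (ltnSn i)) tsi; rewrite /= -tsi.
  by move=> /(_ U tU) [n _ nU]; exists n.
elim: n U nU => [|n IH] U nU.
  by apply: (filterS _ filterT) => s _; apply: nU.
have An : nbhs t [set s : cantor_space | s n = t n].
  have /= := @proj_continuous _ (fun _ : nat => bool) n t [set t n].
  by apply; apply: discrete_set1.
have Bn : nbhs t [set s : cantor_space | s n = t n -> U s].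
  apply: IH => s ts sn; apply: nU => m.
  by rewrite ltnS leq_eqVlt => /predU1P[->//|/ts].
apply: filterS (filterI An Bn) => s [sn]; exact.
Qed.

Lemma CC_at f : CC f -> forall t e, 0 < e ->
  exists n, forall s : cantor_space, agree n t s -> `|f t - f s| < e.
Proof.
move=> Cf t e e0.
have /cvgrPdist_lt/(_ e e0) := Cf t.
by move=> /nbhs_cantorP.
Qed.

Lemma CC_of f : (forall e, 0 < e -> exists n, forall t (s : cantor_space), agree n t s ->
  `|f t - f s| <= e) -> CC f.
Proof.
move=> fu t; apply/cvgrPdist_le => e e0.
apply/nbhs_cantorP; have [n nf] := fu e e0; exists n => s; exact: nf.
Qed.

(** Compactness: finitely many cylinders on which [f] stays within [e / 2] of its value at the base
    point cover the space, and the largest of their lengths is a modulus for [e]. *)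
Lemma CC_unif f : CC f -> forall e, 0 < e ->
  exists n, forall t (s : cantor_space), agree n t s -> `|f t - f s| <= e.
Proof.
move=> Cf e e0.
have := cantor_space_compact; rewrite compact_cover.
have e20 : 0 < e / 2 by lra.
have [N NP] := choice (fun t => CC_at Cf t e20).
move=> /(_ cantor_space setT (fun t => interior [set s : cantor_space | agree (N t) t s])).
case=> [t _|t _|D _ DP].
- exact: open_interior.
- by exists t => //; apply/nbhs_cantorP; exists (N t).
have /finite_seqP[sq sqE] := finite_fset D; rewrite sqE in DP.
have [n nP] : exists n, forall t, t \in sq -> (N t <= n)%N.
  exists (\max_(t <- sq) N t) => t tD.
  by rewrite (big_rem t)//= leq_maxl.
exists n => t s ts.
have [u uD /= /interior_subset/= ut] := DP t I.
rewrite (_ : f t - f s = (f u - f s) - (f u - f t)); last lra.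
rewrite (le_trans (ler_normB _ _))//.
have us : agree (N u) u s.
  by apply: agree_trans ut _; apply: agreeW ts; exact: nP.
by rewrite (splitr e) lerD// ltW// NP.
Qed.

Lemma CC_attain f : CC f -> exists t, forall s, f s <= f t.
Proof.
move=> Cf.
have [||t _ tP] := @compact_EVT_max cantor_space R f setT _ cantor_space_compact.
- by exists point.
- by apply: continuous_subspaceT; exact: Cf.
by exists t => s; apply: tP; rewrite in_setT.
Qed.

Lemma CC0 : @CC R (fun=> 0).
Proof. by apply: CC_of => e e0; exists 0%N => *; rewrite subrr normr0 ltW. Qed.

Lemma CC_lin a f g : CC f -> CC g -> @CC R (fun t => a * f t + g t).
Proof.
move=> Cf Cg t; apply: (@cvgD _ R^o); last exact: Cg.
by apply: cvgM; [exact: cvg_cst|exact: Cf].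
Qed.

Lemma CCD f g : CC f -> CC g -> CC (fun t => f t + g t).
Proof. by move=> Cf Cg t; apply: (@cvgD _ R^o); [exact: Cf|exact: Cg]. Qed.

Lemma CCB f g : CC f -> CC g -> CC (fun t => f t - g t).
Proof. by move=> Cf Cg t; apply: (@cvgB _ R^o); [exact: Cf|exact: Cg]. Qed.

Lemma CCZ a f : CC f -> @CC R (fun t => a * f t).
Proof. by move=> Cf t; apply: cvgM; [exact: cvg_cst|exact: Cf]. Qed.

Lemma CC_norm f : CC f -> @CC R (fun t => `|f t|).
Proof. by move=> Cf t; apply: (@cvg_norm _ R^o); exact: Cf. Qed.

Lemma CC_sum (I : Type) (s : seq I) (P : pred I) (F : I -> fn R) :
  (forall i, P i -> CC (F i)) -> CC (fun t => \sum_(i <- s | P i) F i t).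
Proof.
move=> CF; rewrite (_ : (fun _ => _) = (\sum_(i <- s | P i) F i)); last first.
  by apply/funext => t; rewrite fct_sumE.
elim/big_ind: _ => //; first exact: CC0.
by move=> f g; exact: CCD.
Qed.

Lemma CC_bounded f : CC f -> exists M, forall t, `|f t| <= M.
Proof.
by move=> /CC_norm/CC_attain[t tP]; exists `|f t|.
Qed.

Lemma supnorm_ub f : CC f -> forall t, `|f t| <= supnorm f.
Proof.
move=> Cf t; apply: ub_le_sup; last by exists t.
have [M MP] := CC_bounded Cf.
by exists M => _ [s _ <-].
Qed.

Lemma supnorm_le f M : (forall t, `|f t| <= M) -> supnorm f <= M.
Proof.
move=> fM; apply: ge_sup; first by exists `|f point|; exists point.
by move=> _ [s _ <-].
Qed.

Lemma supnorm_ge0 f : CC f -> 0 <= supnorm f.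
Proof. by move=> /supnorm_ub/(_ point); apply: le_trans. Qed.

Lemma supnorm_lt f e e' : (forall t, `|f t| <= e) -> e < e' -> supnorm f < e'.
Proof. by move=> /supnorm_le; exact: le_lt_trans. Qed.

Lemma CC_complete (s : nat -> fn R) : (forall n, CC (s n)) ->
  (forall e, 0 < e -> exists N, forall n m, (N <= n)%N -> (N <= m)%N ->
     forall t, `|s n t - s m t| <= e) ->
  exists f, CC f /\ forall e, 0 < e -> exists N, forall n, (N <= n)%N ->
    forall t, `|f t - s n t| <= e.
Proof.
move=> Cs sC.
have cv t : cvgn (fun n => s n t).
  apply/cauchy_cvgP/cauchy_exP => e e0.
  have e20 : 0 < e / 2 by lra.
  have [N NP] := sC _ e20.
  exists (s N t); exists N => // n /= Nn.
  rewrite /ball /=; apply: (le_lt_trans (NP _ _ (leqnn N) Nn t)); lra.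
have key e : 0 < e -> exists N, forall n, (N <= n)%N ->
    forall t, `|limn (fun n => s n t) - s n t| <= e.
  move=> e0; have [N NP] := sC _ e0; exists N => n Nn t.
  have cvd : (fun m => `|s m t - s n t|) @ \oo -->
      `|limn (fun n => s n t) - s n t|.
    by apply: cvg_norm; apply: cvgB; [exact: cv|exact: cvg_cst].
  rewrite -(cvg_lim _ cvd)//; apply: limr_le; first by apply/cvg_ex; eexists; exact: cvd.
  by exists N => // m /= Nm; apply: NP.
exists (fun t => limn (fun n => s n t)); split=> //.
apply: CC_of => e e0.
have e30 : 0 < e / 3 by lra.
have [N NP] := key _ e30.
have [k kP] := CC_unif (Cs N) e30.
exists k => t u tu.
have := NP _ (leqnn N) t; have := NP _ (leqnn N) u; have := kP _ _ tu.
rewrite !ler_norml; lra.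
Qed.

End Cantor.

(** * A dense sequence; Suslin sets *)

Section Dense.
Variable R : realType.

(** A rational combination of indicators of cylinders. The lists [q] form a countable type, which
    [dense_fun] enumerates. *)
Definition step_fun (q : seq (seq bool * rat)) : fn R := fun t =>
  \sum_(ur <- q) ratr ur.2 * (ur.1 == mkseq t (size ur.1))%:R.

Lemma CC_step_fun q : CC (step_fun q).
Proof.
apply: CC_sum => ur _; apply: CCZ; apply: CC_of => e e0.
exists (size ur.1) => t s ts.
rewrite (_ : mkseq t _ = mkseq s (size ur.1)) ?subrr ?normr0 ?ltW//.
by apply/eq_in_map => i; rewrite mem_iota => /= ilt; exact: ts.
Qed.

Definition dense_fun (n : nat) : fn R := step_fun (odflt [::] (unpickle n)).

Lemma CC_dense_fun n : CC (dense_fun n).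
Proof. exact: CC_step_fun. Qed.

Lemma dense_funP (f : fn R) e : CC f -> 0 < e ->
  exists n, forall t, `|f t - dense_fun n t| < e.
Proof.
move=> Cf e0; have e20 : 0 < e / 2 by lra.
have [n nP] := CC_unif Cf e20.
pose ext (u : n.-tuple bool) : cantor_space := fun i => nth false u i.
have /choice[c cP] : forall u : n.-tuple bool,
    exists r : rat, `|f (ext u) - ratr r| < e / 2.
  move=> u; have [|r] := @rat_in_itvoo R (f (ext u) - e / 2) (f (ext u) + e / 2).
    lra.
  rewrite in_itv/= => /andP[r1 r2]; exists r.
  by rewrite ltr_norml; apply/andP; split; lra.
exists (pickle [seq (tval u, c u) | u <- enum {: n.-tuple bool}]) => t.
rewrite /dense_fun pickleK /= /step_fun big_map big_enum /=.
have sz : size (mkseq t n) == n by rewrite size_mkseq.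
(* Of all words of length [n], only the initial segment of [t] contributes. *)
rewrite (bigD1 (Tuple sz))//= size_mkseq eqxx mulr1 big1 ?addr0; last first.
  move=> u uS; rewrite size_tuple (_ : _ == _ = false) ?mulr0//.
  by apply: contra_neqF uS => /eqP uS; apply: val_inj.
rewrite (_ : f t - _ = (f t - f (ext (Tuple sz))) +
  (f (ext (Tuple sz)) - ratr (c (Tuple sz)))); last lra.
rewrite (le_lt_trans (ler_normD _ _))// (splitr e) ler_ltD//.
by apply: nP => i ilt; rewrite /ext /= nth_mkseq.
Qed.

End Dense.

Section Suslin.

(** Closedness for the product of the discrete topologies: a point all of whose finite initial
    segments extend to points of [F] lies in [F]. This is the form in which branches of a tree are
    later recognised. *)
Definition closed2 (S T : Type) (F : (nat -> S) -> (nat -> T) -> Prop) :=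
  forall a b, (forall n, exists a' b', [/\ agree n a a', agree n b b' & F a' b'])
    -> F a b.

Definition suslin (S : Type) (E : set (nat -> S)) :=
  exists F : (nat -> S) -> (nat -> nat) -> Prop,
    closed2 F /\ forall a, E a <-> exists b, F a b.

(* [row b n] decodes the [n]-th of countably many sequences packed in [b]. *)
Definition row (b : nat -> nat) (n : nat) : nat -> nat := fun m => b (pickle (n, m)).
Definition unrow (c : nat -> nat -> nat) : nat -> nat := fun k =>
  if unpickle k is Some (n, m) then c n m else 0%N.

Lemma rowK c n : row (unrow c) n = c n.
Proof. by apply/funext => m; rewrite /row /unrow pickleK. Qed.

Lemma agree_row n m b : exists N, forall b', agree N b b' ->
  agree m (row b n) (row b' n).
Proof.
exists (\max_(i <- iota 0 m) pickle (n, i)).+1 => b' bb' i im.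
apply: bb'; rewrite ltnS (big_rem i) /= ?leq_maxl//.
by rewrite mem_iota.
Qed.

(** The first entry of the witness stores the index of the set, and the rest is a witness for that
    set. *)
Lemma suslin_bigcup (S : Type) (E : nat -> set (nat -> S)) :
  (forall n, suslin (E n)) -> suslin (\bigcup_n E n).
Proof.
move=> /choice[F FP].
exists (fun a b => F (b 0%N) a (fun k => b k.+1)); split.
  move=> a b H; have [Fc _] := FP (b 0%N).
  apply: Fc => n; have [a' [b' [aa' bb' Fab]]] := H n.+1.
  exists a', (fun k => b' k.+1); split.
  - exact: agreeW aa'.
  - by move=> m mn; apply: bb'.
  - by rewrite (bb' 0%N).
move=> a; split=> [[n _ /(FP n).2[b Fb]]|[b Fb]].
  by exists (fun k => if k is k'.+1 then b k' else n).
by exists (b 0%N) => //; apply/(FP _).2; eexists; exact: Fb.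
Qed.

(** A single sequence packs one witness per set. Each finite part of a row depends on a finite part
    of the whole, so closedness is preserved. *)
Lemma suslin_bigcap (S : Type) (E : nat -> set (nat -> S)) :
  (forall n, suslin (E n)) -> suslin (\bigcap_n E n).
Proof.
move=> /choice[F FP].
exists (fun a b => forall n, F n a (row b n)); split.
  move=> a b H n; apply: (FP n).1 => m.
  have [N NP] := agree_row n m b.
  have [a' [b' [aa' bb' Fab]]] := H (maxn m N).
  exists a', (row b' n); split=> //.
    by apply: agreeW aa'; exact: leq_maxl.
  by apply: NP; apply: agreeW bb'; exact: leq_maxr.
move=> a; split=> [aE|[b Fb] n _]; last by apply/(FP n).2; exists (row b n).
have /choice[c cP] : forall n, exists b, F n a b by move=> n; apply/(FP n).2/aE.
by exists (unrow c) => n; rewrite rowK.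
Qed.

(** The sets that are Suslin together with their complement form a $\sigma$-algebra, and the
    generators are clopen. *)
Lemma baire_borel_suslin (E : set (nat -> nat)) : baire_borel E -> suslin E.
Proof.
suff: baire_borel `<=` [set E | suslin E /\ suslin (~` E)] by move=> /[apply] -[].
apply: smallest_sub.
- split.
  + rewrite /=; split; last first.
      exists (fun _ _ => True); split=> // a.
      by split=> [_|_ []]; exists (fun=> 0%N).
    exists (fun _ _ => False); split=> [a b /(_ 0%N)[a' [b' []]]//|a].
    by split=> // -[].
  + by move=> A [sA sAc]; rewrite /= setTD setCK.
  + move=> A sA /=; split; first by apply: suslin_bigcup => n; case: (sA n).
    by rewrite setC_bigcup; apply: suslin_bigcap => n; case: (sA n).
- move=> _ [n [k ->]] /=; split.
    exists (fun a _ => a n = k); split=> [a b /(_ n.+1)[a' [b' [aa' _]]]|a].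
      by rewrite aa'.
    by split=> [|[]]//; exists a.
  exists (fun a _ => a n <> k); split=> [a b /(_ n.+1)[a' [b' [aa' _]]]|a].
    by rewrite aa'.
  by split=> [|[]]//; exists a.
Qed.

End Suslin.

(** * Simons' inequality *)

Section HalfPowers.
Variable R : realType.

Lemma half_pow_gt0 n : 0 < (2^-1 : R) ^+ n.
Proof. by rewrite exprn_gt0// invr_gt0. Qed.

Lemma half_pow_small (e : R) : 0 < e -> exists N, (2^-1) ^+ N <= e.
Proof.
move=> e0; have ei : 0 <= e^-1 by rewrite invr_ge0 ltW.
exists (Num.bound e^-1); have := archi_boundP ei.
set N := Num.bound _ => eN.
rewrite exprVn invf_ple ?posrE ?exprn_gt0//.
apply: (le_trans (ltW eN)).
by rewrite -natrX ler_nat ltnW// ltn_expl.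
Qed.

Lemma half_pow_le m n : (m <= n)%N -> (2^-1 : R) ^+ n <= (2^-1) ^+ m.
Proof. by move=> mn; rewrite ler_wiXn2l//; lra. Qed.

End HalfPowers.

Section Simons.
Variables (R : realType) (G : nat -> fn R).

(** The convex hull of the [G j] with [n <= j], generated by binary convex combinations so that its
    properties follow by induction. *)
Inductive tail_conv (n : nat) : fn R -> Prop :=
| tail_conv_gen j of (n <= j)%N : tail_conv n (G j)
| tail_conv_mix a h k of 0 <= a <= 1 & tail_conv n h & tail_conv n k :
    tail_conv n (fun t => a * h t + (1 - a) * k t).

Lemma tail_convW m n h : (m <= n)%N -> tail_conv n h -> tail_conv m h.
Proof.
move=> mn; elim=> [j nj|a h1 h2 a01 _ IH1 _ IH2]; last exact: tail_conv_mix.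
by apply: tail_conv_gen; apply: leq_trans nj.
Qed.

Lemma tail_conv_CC n h : (forall j, CC (G j)) -> tail_conv n h -> CC h.
Proof.
move=> CG; elim=> // a h1 h2 _ _ C1 _ C2.
by apply: CC_lin => //; exact: CCZ.
Qed.

Lemma tail_conv_ge0 n h t : (forall j, 0 <= G j t) -> tail_conv n h -> 0 <= h t.
Proof.
by move=> G0; elim=> // a h1 h2 a01 _ H1 _ H2; nra.
Qed.

Lemma tail_conv_le n h t M : (forall j, (n <= j)%N -> G j t <= M) ->
  tail_conv n h -> h t <= M.
Proof.
by move=> GM; elim=> [j /GM//|a h1 h2 a01 _ H1 _ H2]; nra.
Qed.

(* Almost minimising the norm of [S_n + 2^-n y] over the convex tails forces
   the norms of the partial sums [S_n] to grow like those of a geometric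
   series, so at a maximum point of the limit all tails are large. *)
Lemma simons M c : 0 < c -> (forall j, CC (G j)) ->
  (forall j t, 0 <= G j t <= M) ->
  (forall h, tail_conv 0 h -> exists t, c <= h t) ->
  exists t, forall n, exists j, (n <= j)%N /\ c / 4 <= G j t.
Proof.
move=> c0 CG GM Gc.
pose r n : R := 2^-1 ^+ n.
have r0 n : 0 < r n := half_pow_gt0 R n.
have rS n : r n.+1 = r n / 2 by rewrite /r exprSr.
have C_CC n h : tail_conv n h -> CC h by apply: tail_conv_CC.
have C_ge0 n h t : tail_conv n h -> 0 <= h t.
  by apply: tail_conv_ge0 => j; have /andP[] := GM j t.
have C_leM n h t : tail_conv n h -> h t <= M.
  by apply: tail_conv_le => j _; have /andP[] := GM j t.
have M0 : 0 <= M by have /andP[+ +] := GM 0%N point; apply: le_trans.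
(* The state is the index together with the partial sum. The tolerance is quadratic in [r n], hence
   negligible against the increments of order [r n] expected below. *)
have step (nS : nat * fn R) : exists y, CC nS.2 -> tail_conv nS.1 y /\
    forall z, tail_conv nS.1 z ->
      supnorm (fun t => nS.2 t + r nS.1 * y t) <=
      supnorm (fun t => nS.2 t + r nS.1 * z t) + c * r nS.1 ^+ 2 / 12.
  case: nS => n S /=; have [CS|nCS] := pselect (CC S); last by exists (G n).
  pose E := [set supnorm (fun t => S t + r n * z t) | z in tail_conv n].
  have CE z : tail_conv n z -> CC (fun t => S t + r n * z t).
    by move=> /C_CC Cz; apply: CCD => //; exact: CCZ.
  have hE : has_inf E.
    split; first by exists (supnorm (fun t => S t + r n * G n t)); exists (G n) => //; exact: tail_conv_gen.
    by exists 0 => _ [z /CE Cz <-]; exact: supnorm_ge0.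
  have d0 : 0 < c * r n ^+ 2 / 12 by rewrite divr_gt0// mulr_gt0// exprn_gt0.
  have [_ [y Cy <-] yP] := inf_adherent d0 hE.
  exists y => _; split=> // z Cz; apply: (le_trans (ltW yP)).
  by rewrite lerD2r; apply: ge_inf; [case: hE|exists z].
have [Y YP] := choice step.
pose fix S n : fn R := if n is n'.+1 then
  (fun t => S n' t + r n' * Y (n', S n') t) else (fun=> 0).
pose y n := Y (n, S n).
have CS n : CC (S n).
  elim: n => [|n IH]; first exact: CC0.
  have [/= Cy _] := YP (n, S n) IH.
  by apply: CCD => //; apply: CCZ; apply: C_CC Cy.
have Cy n : tail_conv n (y n) by have [] := YP (n, S n) (CS n).
have Smin n z : tail_conv n z -> supnorm (S n.+1) <=
    supnorm (fun t => S n t + r n * z t) + c * r n ^+ 2 / 12.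
  by have [_] := YP (n, S n) (CS n); apply.
have SS n t : S n.+1 t = S n t + r n * y n t by [].
have S0 n t : 0 <= S n t.
  elim: n => [//|n IH]; rewrite SS addr_ge0// mulr_ge0//; first exact: ltW.
  exact: C_ge0 (Cy n).
have P_ge n t : S n t <= supnorm (S n).
  by apply: le_trans (supnorm_ub (CS n) t); exact: ler_norm.
have P_le n B : (forall t, S n t <= B) -> supnorm (S n) <= B.
  by move=> SB; apply: supnorm_le => t; rewrite ger0_norm.
(* The competitor [2/3 y n + 1/3 y n.+1] is chosen because adding [r n] times it to [S n] gives
   exactly [1/3 S n + 2/3 S n.+2]. *)
have P2 n : 3 * supnorm (S n.+1) <= supnorm (S n) + 2 * supnorm (S n.+2)
    + 3 * (c * r n ^+ 2 / 12).
  have C2 : tail_conv n (fun t => 2/3 * y n t + (1 - 2/3) * y n.+1 t).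
    apply: tail_conv_mix => //; first by lra.
    by apply: tail_convW (Cy n.+1).
  have := Smin n _ C2.
  suff : supnorm (fun t => S n t + r n * (2 / 3 * y n t + (1 - 2 / 3) * y n.+1 t))
      <= 1/3 * supnorm (S n) + 2/3 * supnorm (S n.+2) by lra.
  apply: supnorm_le => t.
  have -> : S n t + r n * (2 / 3 * y n t + (1 - 2 / 3) * y n.+1 t) =
      1/3 * S n t + 2/3 * S n.+2 t.
    by rewrite (SS n.+1) (SS n) rS; field.
  have := P_ge n t; have := P_ge n.+2 t; have := S0 n t; have := S0 n.+2 t.
  move=> *; rewrite ger0_norm; lra.
(* The surplus [r n ^+ 2] pays for the tolerance in [P2]: the bound reproduces itself exactly from
   [n] to [n.+1]. For [n = 0] it reads [c]. *)
have D n : c / 2 * (r n + r n ^+ 2) <= supnorm (S n.+1) - supnorm (S n).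
  elim: n => [|n IH].
    have -> : supnorm (S 0%N) = 0.
      by apply/eqP; rewrite eq_le supnorm_ge0// andbT; apply: P_le => t.
    have [t] := Gc _ (Cy 0%N); have := P_ge 1%N t; rewrite SS /r expr0 /=.
    by rewrite -/(y 0%N); lra.
  have := P2 n; rewrite rS; move: IH; rewrite !expr2; nra.
have {}D n : c / 2 * r n <= supnorm (S n.+1) - supnorm (S n).
  apply: le_trans (D n); rewrite ler_wpM2l ?lerDl ?sqr_ge0//; lra.
have tele n m : (n <= m)%N -> c * (r n - r m) <= supnorm (S m) - supnorm (S n).
  move=> /subnK <-; elim: (m - n)%N => [|k IH]; first by rewrite subrr mulr0 add0n subrr.
  rewrite addSn; have := D (k + n)%N; rewrite rS; move: IH; lra.
have Smono n m t : (n <= m)%N -> S n t <= S m t.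
  move=> /subnK <-; elim: (m - n)%N => [//|k IH].
  rewrite addSn SS; apply: (le_trans IH); rewrite lerDl mulr_ge0//; first exact: ltW.
  exact: C_ge0 (Cy _).
have Sup (B : R) n m t : (forall i, (n <= i)%N -> y i t <= B) -> (n <= m)%N ->
    S m t <= S n t + 2 * B * (r n - r m).
  move=> yB /subnK <-; elim: (m - n)%N => [|k IH].
    by rewrite add0n subrr mulr0 addr0.
  rewrite addSn SS rS.
  have : r (k + n)%N * y (k + n)%N t <= r (k + n)%N * B.
    by apply: ler_wpM2l; [exact: ltW|apply: yB; exact: leq_addl].
  move: IH; lra.
have [Si [CSi SiP]] : exists f, CC f /\ forall e, 0 < e ->
    exists N, forall n, (N <= n)%N -> forall t, `|f t - S n t| <= e.
  apply: CC_complete => // e e0.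
  have [|N NP] := @half_pow_small R (e / (2 * M + 1)); first by rewrite divr_gt0//; lra.
  have {}NP : 2 * M * r N <= e.
    rewrite ler_pdivlMr ?ltr_pwDr ?mulr_ge0// in NP.
    by move: NP; rewrite -/(r N); have := r0 N; lra.
  have S_N n t : (N <= n)%N -> S N t <= S n t <= S N t + e.
    move=> Nn; rewrite Smono//=.
    have := @Sup M N n t (fun i _ => C_leM _ _ _ (Cy i)) Nn.
    by have := r0 n; nra.
  exists N => n m Nn Nm t; have := S_N n t Nn; have := S_N m t Nm.
  rewrite ler_norml; lra.
have SiS n t : S n t <= Si t.
  apply/ler_addgt0Pr => e /SiP[N NP].
  have := NP (maxn n N) (leq_maxr _ _) t; have := @Smono n (maxn n N) t (leq_maxl _ _).
  rewrite ler_norml; lra.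
have [t tmax] := CC_attain CSi.
exists t => n; apply: contrapT => nH.
have Gn j : (n <= j)%N -> G j t <= c / 4.
  move=> nj; rewrite leNgt; apply/negP => H; apply: nH; exists j; split=> //.
  exact: ltW.
have yn i : (n <= i)%N -> y i t <= c / 4.
  move=> ni; apply: (@tail_conv_le i); last exact: Cy.
  by move=> j ij; apply: Gn; apply: leq_trans ij.
have PSi m : supnorm (S m) <= Si t.
  by apply: P_le => s; apply: le_trans (tmax s).
(* If all [G j t] with [n <= j] were at most [c / 4], then from [n] to a late [m] the sums at [t]
   would grow by at most [c / 2 * (r n - r m)], while the norms grow by at least [c * (r n - r m)].
   Since [t] maximises the limit, the two rates conflict once [r m] and the distance to the limit
   are small compared with [r n]. *)
have [|m1 m1P] := @half_pow_small R (r n / 8); first by rewrite divr_gt0.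
have [|m2 m2P] := SiP (c * r n / 8); first by rewrite divr_gt0// mulr_gt0.
pose m := maxn n (maxn m1 m2).
have nm : (n <= m)%N by exact: leq_maxl.
have m1m : (m1 <= m)%N by rewrite /m !leq_max leqnn orbT.
have m2m : (m2 <= m)%N by rewrite /m !leq_max leqnn !orbT.
have rm : r m <= r n / 8 by apply: le_trans m1P; exact: half_pow_le.
have := m2P m m2m t; rewrite ler_norml => /andP[_ H1].
have H2 := tele n m nm; have H3 := PSi m; have H4 := P_ge n t.
have H5 := Sup _ n m t yn nm; have H6 := r0 m; have H7 := r0 n.
nra.
Qed.

End Simons.

(** * Unconditional sequences and their perturbations *)

Section SequencesInC.
Variable R : realType.
Implicit Types (e d : nat -> fn R) (a b : nat -> R).

Lemma real_complete (s : nat -> R) :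
  (forall eps : R, 0 < eps -> exists N, forall n m, (N <= n)%N -> (N <= m)%N ->
     `|s n - s m| <= eps) ->
  exists l, forall eps : R, 0 < eps -> exists N, forall n, (N <= n)%N ->
    `|l - s n| <= eps.
Proof.
move=> sC.
have Cc (c : R) : @CC R (fun=> c).
  by apply: CC_of => eps eps0; exists 0%N => *; rewrite subrr normr0 ltW.
(* Real numbers are treated as constant functions. *)
have [|f [_ fP]] := @CC_complete R (fun n _ => s n) (fun n => Cc (s n)).
  by move=> eps /sC[N NP]; exists N => n m Nn Nm _; exact: NP.
by exists (f point) => eps /fP[N NP]; exists N => n Nn; exact: NP.
Qed.

Lemma sum_approx (u : nat -> nat -> R) a (w : nat -> R) (s : seq nat) :
  (forall n eps, 0 < eps -> exists N, forall j, (N <= j)%N -> `|a n - u j n| <= eps) ->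
  forall eps : R, 0 < eps -> exists N, forall j, (N <= j)%N ->
    `|\sum_(n <- s) (a n - u j n) * w n| <= eps.
Proof.
move=> ua; elim: s => [|n s IH] eps e0.
  by exists 0%N => j _; rewrite big_nil normr0 ltW.
have e20 : 0 < eps / 2 by lra.
have [N1 N1P] := IH _ e20.
have w0 : 0 < `|w n| + 1 by rewrite ltr_wpDl.
have [|N2 N2P] := ua n (eps / 2 / (`|w n| + 1)); first exact: divr_gt0.
exists (maxn N1 N2) => j; rewrite geq_max => /andP[/N1P jN1 /N2P jN2].
rewrite big_cons (le_trans (ler_normD _ _))// (splitr eps) lerD//.
rewrite normrM; move: jN2; rewrite ler_pdivlMr//; apply: le_trans.
by apply: ler_wpM2l => //; rewrite lerDl.
Qed.

Lemma series_convP x e a : CC x -> (forall n, CC (e n)) ->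
  series_conv x e a <-> (forall eps : R, 0 < eps -> exists N0, forall N,
    (N0 <= N)%N -> forall t, `|x t - \sum_(n < N) a n * e n t| <= eps).
Proof.
move=> Cx Ce; split=> H eps eps0.
  have [N0 N0P] := H _ eps0; exists N0 => N /N0P /ltW + t.
  apply: le_trans; apply: (@supnorm_ub _ (fun t => x t - _)).
  by apply: CCB => //; apply: CC_sum => i _; exact: CCZ.
have [|N0 N0P] := H (eps / 2); first lra.
exists N0 => N /N0P NP; apply: (@supnorm_lt _ _ (eps / 2)) => //; lra.
Qed.

Lemma series_conv_eq x y e a b : x =1 y -> a =1 b ->
  series_conv x e a -> series_conv y e b.
Proof. by move=> /funext -> /funext ->. Qed.

Lemma series_conv_lin x y e a b c : CC x -> CC y -> (forall n, CC (e n)) ->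
  series_conv x e a -> series_conv y e b ->
  series_conv (fun t => c * x t + y t) e (fun n => c * a n + b n).
Proof.
move=> Cx Cy Ce /series_convP-/(_ Cx Ce) xa /series_convP-/(_ Cy Ce) yb.
apply/series_convP => //; first exact: CC_lin.
move=> eps eps0.
have c0 : 0 < `|c| + 1 by rewrite ltr_wpDl.
have [|N1 N1P] := xa (eps / 2 / (`|c| + 1)); first by rewrite !divr_gt0.
have [|N2 N2P] := yb (eps / 2); first by rewrite divr_gt0.
exists (maxn N1 N2) => N; rewrite geq_max => /andP[/N1P NN1 /N2P NN2] t.
rewrite (_ : _ - _ = c * (x t - \sum_(n < N) a n * e n t) +
  (y t - \sum_(n < N) b n * e n t)); last first.
  under eq_bigr do rewrite mulrDl -mulrA.
  by rewrite big_split /= -mulr_sumr; ring.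
rewrite (le_trans (ler_normD _ _))// (splitr eps) lerD// normrM.
have := NN1 t; rewrite ler_pdivlMr// mulrC; apply: le_trans.
by apply: ler_wpM2r => //; rewrite lerDl.
Qed.

Lemma series_conv_fin e (s : seq nat) a : (forall n, CC (e n)) -> uniq s ->
  series_conv (fun t => \sum_(n <- s) a n * e n t) e
    (fun n => if n \in s then a n else 0).
Proof.
move=> Ce us eps eps0; exists (\max_(n <- s) n).+1 => N sN.
apply: (@supnorm_lt _ _ 0) => // t.
suff -> : \sum_(n < N) (if (n : nat) \in s then a n else 0) * e n t =
    \sum_(n <- s) a n * e n t by rewrite subrr normr0.
rewrite -(big_mkord xpredT (fun n => (if n \in s then a n else 0) * e n t)).
under eq_bigr do rewrite (fun_if ( *%R^~ _)) mul0r.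
rewrite -big_mkcond -big_filter; apply: perm_big.
apply: uniq_perm => //; first by rewrite filter_uniq// iota_uniq.
move=> n; rewrite mem_filter mem_index_iota /=; case: (boolP (n \in s)) => //= ns.
by apply: leq_trans sN; rewrite ltnS (big_rem n)//= leq_maxl.
Qed.

Lemma sum_half_le (s : seq nat) : uniq s -> \sum_(n <- s) (2^-1 : R) ^+ n <= 2.
Proof.
move=> us; pose N := (\max_(n <- s) n).+1.
have -> : \sum_(n <- s) (2^-1 : R) ^+ n =
    \sum_(n <- iota 0 N | n \in s) (2^-1) ^+ n.
  rewrite -[RHS]big_filter; apply: perm_big; apply: uniq_perm => //.
    by rewrite filter_uniq// iota_uniq.
  move=> n; rewrite mem_filter mem_iota /=; case: (boolP (n \in s)) => //= ns.
  by apply/esym; rewrite add0n ltnS (big_rem n)//= leq_maxl.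
apply: (@le_trans _ _ (\sum_(n <- iota 0 N) (2^-1 : R) ^+ n)).
  by rewrite big_mkcond; apply: ler_sum => n _; case: ifP.
apply: (@le_trans _ _ (2 - 2 * 2^-1 ^+ N)); last first.
  by have := half_pow_gt0 R N; lra.
elim: N => [|N IH]; first by rewrite big_nil expr0; lra.
by rewrite -addn1 iotaD big_cat /= big_seq1 add0n addn1 exprSr; lra.
Qed.

(** The suppression form of the unconditional constant, for finite sums only; the pointwise bound
    [M] stands for the sup norm. *)
Definition unc_const (K : R) d := forall (s : seq nat) (p : pred nat) a M,
  uniq s -> (forall t, `|\sum_(n <- s) a n * d n t| <= M) ->
  forall t, `|\sum_(n <- s | p n) a n * d n t| <= K * M.

Lemma unc_const_coef K d (s : seq nat) a M n t : unc_const K d -> uniq s ->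
  (forall t, `|\sum_(n <- s) a n * d n t| <= M) ->
  n \in s -> `|a n * d n t| <= K * M.
Proof.
move=> ud us sM ns; have := ud s (pred1 n) a M us sM t.
by rewrite -big_filter filter_pred1_uniq// big_seq1.
Qed.

(** At the given point [t], project separately onto the indices with nonnegative and with negative
    terms; each half costs [K * M]. *)
Lemma unc_const_abs K d (s : seq nat) a M t : unc_const K d -> uniq s ->
  (forall t, `|\sum_(n <- s) a n * d n t| <= M) ->
  \sum_(n <- s) `|a n * d n t| <= 2 * K * M.
Proof.
move=> ud us sM.
pose p := [pred n | 0 <= a n * d n t].
have H1 := ud s p a M us sM t; have H2 := ud s (predC p) a M us sM t.
rewrite (bigID p)/=.
have -> : \sum_(n <- s | 0 <= a n * d n t) `|a n * d n t| =
    \sum_(n <- s | 0 <= a n * d n t) a n * d n t.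
  by apply: eq_bigr => n n0; rewrite ger0_norm.
have -> : \sum_(n <- s | ~~ (0 <= a n * d n t)) `|a n * d n t| =
    - \sum_(n <- s | ~~ (0 <= a n * d n t)) a n * d n t.
  by rewrite -sumrN; apply: eq_bigr => n; rewrite -ltNge => n0; rewrite ltr0_norm.
by move: H1 H2; rewrite /= !ler_norml; lra.
Qed.

Lemma unc_const_le K K' d : K <= K' -> unc_const K d -> unc_const K' d.
Proof.
move=> KK ud s p a M us sM t; apply: (le_trans (ud s p a M us sM t)).
by apply: ler_wpM2r => //; apply: le_trans (sM point).
Qed.

(** Since [d n] reaches modulus 1, projecting onto one coordinate bounds each [a n] by [K] times the
    norm of the [d]-sum. The two sums then differ by at most half of that norm. The converse
    estimate absorbs this half on the left. *)
Lemma perturb K d e : 0 < K -> (forall n, CC (d n)) ->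
  (forall n, exists t, 1 <= `|d n t|) -> unc_const K d ->
  (forall n t, `|e n t - d n t| <= 2^-1 ^+ n / (4 * K)) ->
  forall (s : seq nat) a M, uniq s ->
    ((forall t, `|\sum_(n <- s) a n * d n t| <= M) ->
      forall t, `|\sum_(n <- s) a n * e n t| <= 3 / 2 * M) /\
    ((forall t, `|\sum_(n <- s) a n * e n t| <= M) ->
      forall t, `|\sum_(n <- s) a n * d n t| <= 2 * M).
Proof.
move=> K0 Cd d1 ud ed s a M us.
have key B : (forall t, `|\sum_(n <- s) a n * d n t| <= B) ->
    forall t, `|\sum_(n <- s) a n * e n t - \sum_(n <- s) a n * d n t| <= B / 2.
  move=> sB t.
  have B0 : 0 <= B by apply: le_trans (sB point).
  rewrite -sumrB (le_trans (ler_norm_sum _ _ _))//.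
  apply: (@le_trans _ _ (\sum_(n <- s) (B / 4) * 2^-1 ^+ n)).
    rewrite big_seq [leRHS]big_seq; apply: ler_sum => n ns.
    rewrite -mulrBr normrM.
    have [tn tnP] := d1 n.
    have := unc_const_coef tn ud us sB ns; rewrite normrM => an.
    have {}an : `|a n| <= K * B by apply: le_trans an; rewrite ler_peMr.
    apply: (@le_trans _ _ (K * B * (2^-1 ^+ n / (4 * K)))).
      by apply: ler_pM.
    by rewrite le_eqVlt; apply/orP; left; apply/eqP; field; rewrite gt_eqF.
  rewrite -mulr_sumr; have := sum_half_le us.
  move=> /(ler_wpM2l (_ : 0 <= B / 4)) H; have := H (divr_ge0 B0 _); lra.
split=> [sM t|sM].
  have := key M sM t; have := sM t; rewrite !ler_norml; lra.
pose S := fun t => \sum_(n <- s) a n * d n t.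
have CS : CC S by apply: CC_sum => n _; exact: CCZ.
have SS := supnorm_ub CS.
have : supnorm S <= M + supnorm S / 2.
  apply: supnorm_le => t; have := key _ SS t; have := sM t.
  by rewrite -/(S t) !ler_norml; lra.
by move=> H t; apply: (le_trans (SS t)); lra.
Qed.

Lemma perturb_unc K d e : 0 < K -> (forall n, CC (d n)) ->
  (forall n, exists t, 1 <= `|d n t|) -> unc_const K d ->
  (forall n t, `|e n t - d n t| <= 2^-1 ^+ n / (4 * K)) ->
  unc_const (3 * K) e.
Proof.
move=> K0 Cd d1 ud ed s p a M us sM t.
have H1 := (perturb K0 Cd d1 ud ed a M us).2 sM.
have H2 := ud s p a _ us H1.
rewrite -big_filter.
have := (perturb K0 Cd d1 ud ed a (K * (2 * M)) (filter_uniq p us)).1.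
(* Pass from [e] to [d] (factor 2), project (factor [K]), and return to [e] (factor 3/2). *)
move=> /(_ _ t) H3; have : 3 / 2 * (K * (2 * M)) = 3 * K * M by field.
by move=> <-; apply: H3 => u; rewrite big_filter.
Qed.

End SequencesInC.

(** * The unconditional constant of a basis *)

Section UnconditionalConstant.
Variables (R : realType) (X : set (fn R)) (e : nat -> fn R).
Hypothesis sX : closed_subspace X.
Hypothesis Xe : forall n, X (e n).
Hypothesis eP : forall x, X x ->
  (exists! a : nat -> R, series_conv x e a) /\
  (forall a, series_conv x e a -> uncond_conv x e a).

Let XCC x : X x -> CC x. Proof. by case: sX => + _ _ _; apply. Qed.
Let Ce n : CC (e n). Proof. exact: XCC. Qed.
Let X0 : X (fun=> 0). Proof. by case: sX. Qed.
Let Xlin (c : R) x y : X x -> X y -> X (fun t => c * x t + y t).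
Proof. by case: sX => _ _ + _; apply. Qed.

Lemma series_conv_unique x a b :
  X x -> series_conv x e a -> series_conv x e b -> a = b.
Proof. by move=> /eP[[c [_ cP]] _] /cP <- /cP. Qed.

Lemma subspace_limit f : CC f ->
  (forall eps : R, 0 < eps -> exists2 g, X g & forall t, `|f t - g t| <= eps) -> X f.
Proof.
move=> Cf fg; case: sX => _ _ _; apply=> // eps eps0.
have [|g Xg gP] := fg (eps / 2); first lra.
by exists g => //; apply: (supnorm_lt gP); lra.
Qed.

(** The vectors all of whose finite coordinate sums are bounded by [k]. The sets for integer [k]
    cover [X], which starts the Baire category and open mapping argument for a finite unconditional
    constant. *)
Let XK (k : R) x := X x /\ exists a, series_conv x e a /\
  forall s, uniq s -> forall t, `|\sum_(n <- s) a n * e n t| <= k.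

Let XK_cover x : X x -> exists k : nat, XK k%:R x.
Proof.
move=> Xx; have [[a [xa _]] xu] := eP Xx.
have [N0 N0P] := xu a xa 1 ltr01.
pose B := supnorm x + 1 + \sum_(n <- iota 0 N0) supnorm (fun t => a n * e n t).
have B0 : 0 <= B.
  rewrite addr_ge0 ?addr_ge0 ?supnorm_ge0 ?sumr_ge0//; first exact: XCC.
  by move=> n _; apply: supnorm_ge0; exact: CCZ.
exists (Num.bound B); split=> //; exists a; split=> // s us t.
apply: (le_trans _ (ltW (archi_boundP B0))).
(* Completing [s] by the missing indices below [N0] brings the sum within 1 of [x]; the added terms
   cost at most the total norm of the first [N0] terms. *)
pose s' := [seq n <- iota 0 N0 | n \notin s].
have us' : uniq (s ++ s').
  rewrite cat_uniq us filter_uniq ?iota_uniq// andbT/=.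
  by apply/hasPn => n; rewrite mem_filter => /andP[].
have Ns n : (n < N0)%N -> n \in s ++ s'.
  by move=> nN; rewrite mem_cat mem_filter mem_iota /= add0n nN andbT orbN.
have /ltW H1 := N0P _ us' Ns.
have {}H1 : `|x t - \sum_(n <- s ++ s') a n * e n t| <= 1.
  apply: le_trans H1; apply: (@supnorm_ub _ (fun t => x t - _)).
  by apply: CCB; [exact: XCC|apply: CC_sum => i _; exact: CCZ].
have H2 := supnorm_ub (XCC Xx) t.
have H3 : `|\sum_(n <- s') a n * e n t| <=
    \sum_(n <- iota 0 N0) supnorm (fun t => a n * e n t).
  apply: (le_trans (ler_norm_sum _ _ _)).
  rewrite big_filter big_mkcond; apply: ler_sum => n _; case: ifP => _.
    by apply: (@supnorm_ub _ (fun t => a n * e n t)); exact: CCZ.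
  by apply: supnorm_ge0; exact: CCZ.
move: H1 H2 H3; rewrite big_cat/= /B !ler_norml; lra.
Qed.

(** Baire category by hand: otherwise nested balls could be chosen, the one of stage [k.+1] missing
    [XK k], and the limit of their centres would lie in no [XK k]. *)
Let XK_dense : exists (k : nat) x0 (r : R), [/\ X x0, 0 < r &
  forall x, X x -> (forall t, `|x t - x0 t| <= r) -> forall eps : R, 0 < eps ->
    exists y, XK k%:R y /\ forall t, `|x t - y t| <= eps].
Proof.
apply: contrapT => H.
have step (p : nat * (fn R * R)) : exists q : fn R * R,
    X p.2.1 -> 0 < p.2.2 -> [/\ X q.1, 0 < q.2, q.2 <= p.2.2 / 2,
     (forall t, `|q.1 t - p.2.1 t| <= p.2.2 / 2) &
     forall y, XK p.1%:R y -> exists t, q.2 < `|q.1 t - y t|].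
  case: p => k [x0 r] /=.
  have [[Xx0 r0]|nXr] := pselect (X x0 /\ 0 < r); last first.
    by exists (x0, r) => *; exfalso; apply: nXr.
  have r20 : 0 < r / 2 by lra.
  have : ~ forall x, X x -> (forall t, `|x t - x0 t| <= r / 2) ->
      forall eps : R, 0 < eps -> exists y, XK k%:R y /\ forall t, `|x t - y t| <= eps.
    by move=> H'; apply: H; exists k, x0, (r / 2).
  move=> /existsNP[x /not_implyP[Xx /not_implyP[xx0 /existsNP[eps
    /not_implyP[eps0 /forallNP yP]]]]].
  exists (x, Num.min (r / 2) eps) => _ _; split=> //=.
  - by rewrite lt_min r20.
  - by rewrite ge_min lexx.
  - move=> y XKy; apply: contrapT => /forallNP nt; apply: (yP y); split=> // t.
    rewrite leNgt; apply/negP => epst; apply: (nt t).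
    by rewrite gt_min epst orbT.
have [F FP] := choice step.
pose fix st n : fn R * R := if n is n'.+1 then F (n', st n') else (fun=> 0, 1).
have inv n : X (st n).1 /\ 0 < (st n).2.
  elim: n => [//|n [IH1 IH2]]; have [] := FP (n, st n) IH1 IH2.
  by move=> *; split.
have rec n : [/\ (st n.+1).2 <= (st n).2 / 2,
    (forall t, `|(st n.+1).1 t - (st n).1 t| <= (st n).2 / 2) &
    forall y, XK n%:R y -> exists t, (st n.+1).2 < `|(st n.+1).1 t - y t|].
  by have [i1 i2] := inv n; have [] := FP (n, st n) i1 i2; split.
have near n m t : (n <= m)%N -> `|(st m).1 t - (st n).1 t| <= (st n).2 - (st m).2.
  move=> /subnK <-; elim: (m - n)%N => [|k IH].
    by rewrite add0n !subrr normr0.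
  have [H1 /(_ t) H2 _] := rec (k + n)%N.
  by rewrite addSn; move: IH H1 H2; rewrite !ler_norml; lra.
have r_le n : (st n).2 <= 2^-1 ^+ n.
  elim: n => [//|n IH]; have [H1 _ _] := rec n.
  by rewrite exprSr; lra.
have near' n m t : (n <= m)%N -> `|(st m).1 t - (st n).1 t| <= (st n).2.
  by move=> nm; apply: (le_trans (near n m t nm)); have [] := inv m; lra.
have [z [Cz zP]] : exists f, CC f /\ forall eps : R, 0 < eps ->
    exists N, forall n, (N <= n)%N -> forall t, `|f t - (st n).1 t| <= eps.
  apply: CC_complete => [n|eps eps0]; first by apply: XCC; have [] := inv n.
  have [|N NP] := @half_pow_small R (eps / 2); first by rewrite divr_gt0.
  exists N => n m Nn Nm t; have := near' _ _ t Nn; have := near' _ _ t Nm.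
  by have := r_le N; rewrite !ler_norml; lra.
have Xz : X z.
  apply: subspace_limit => // eps /zP[N NP].
  by exists (st N).1; [have [] := inv N|exact: NP].
have [k zk] := XK_cover Xz.
have [_ _ /(_ z zk)[t]] := rec k; apply/negP; rewrite -leNgt.
apply/ler_addgt0Pr => eps /zP[N NP].
have := NP (maxn N k.+1) (leq_maxl _ _) t.
have := near' k.+1 (maxn N k.+1) t (leq_maxr _ _).
rewrite !ler_norml; lra.
Qed.

(** Rescale [x] into the ball of [XK_dense], approximate both the shifted vector and the centre [x0]
    from [XK k] within [r / 4], and subtract. The difference has coordinate sums at most [2 * k],
    and scaling back by [rho / r] gives the constant. *)
Let open_mapping : exists2 Q : R, 0 <= Q & forall rho x, 0 < rho -> X x ->
  (forall t, `|x t| <= rho) -> exists y a, [/\ X y, series_conv y e a,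
    (forall s, uniq s -> forall t, `|\sum_(n <- s) a n * e n t| <= Q * rho) &
    forall t, `|x t - y t| <= rho / 2].
Proof.
have [k [x0 [r [Xx0 r0 H]]]] := XK_dense.
exists (2 * k%:R / r); first by rewrite divr_ge0 ?mulr_ge0// ltW.
move=> rho x rho0 Xx xrho.
have c0 : 0 < r / rho by rewrite divr_gt0.
have [||y1 [[Xy1 [a1 [ya1 ab1]]] xy1]] := H _ (Xlin (r / rho) Xx Xx0) _ (r / 4).
- move=> t; rewrite addrK normrM gtr0_norm//.
  by have := ler_wpM2l (ltW c0) (xrho t); rewrite divfK// gt_eqF.
- lra.
have [||y2 [[Xy2 [a2 [ya2 ab2]]] xy2]] := H _ Xx0 _ (r / 4).
- by move=> t; rewrite subrr normr0 ltW.
- lra.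
pose c := rho / r.
have c'0 : 0 < c by rewrite divr_gt0.
pose y := fun t => c * y1 t + ((- c) * y2 t + 0).
exists y, (fun n => c * a1 n + ((- c) * a2 n + 0)).
have s0 : series_conv (fun=> 0) e (fun=> 0 : R).
  by have := @series_conv_fin _ e [::] (fun=> 0) Ce isT; under eq_fun do rewrite big_nil.
split.
- by do 2![apply: Xlin => //].
- have Xy2' := Xlin (- c) Xy2 X0.
  apply: (series_conv_lin c (XCC Xy1) (XCC Xy2') Ce ya1).
  exact: (series_conv_lin (- c) (XCC Xy2) (XCC X0) Ce ya2).
- move=> s us t.
  have -> : \sum_(n <- s) (c * a1 n + (- c * a2 n + 0)) * e n t =
     c * (\sum_(n <- s) a1 n * e n t - \sum_(n <- s) a2 n * e n t).
    by rewrite mulrBr !mulr_sumr -sumrB; apply: eq_bigr => n _; ring.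
  rewrite normrM gtr0_norm// (_ : 2 * _ / _ * _ = c * (2 * k%:R)); last by rewrite /c; field; rewrite gt_eqF.
  apply: ler_wpM2l; first exact: ltW.
  by have := ab1 s us t; have := ab2 s us t; rewrite !ler_norml; lra.
- move=> t; rewrite (_ : x t - y t = c * ((r / rho * x t + x0 t - y1 t)
     - (x0 t - y2 t))); last first.
    by rewrite /y /c; field; rewrite !gt_eqF.
  rewrite normrM gtr0_norm// (_ : rho / 2 = c * (r / 2)); last by rewrite /c; field; rewrite gt_eqF.
  apply: ler_wpM2l; first exact: ltW.
  by have := xy1 t; have := xy2 t; rewrite !ler_norml; lra.
Qed.

(** A vanishing [e n] would give the zero vector several expansions. *)
Lemma basis_nz n : exists t, e n t != 0.
Proof.
apply: contrapT => /forallNP en0.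
have {}en0 t : e n t = 0 by apply/eqP/negPn/negP/en0.
have H b : series_conv (fun=> 0) e (fun m => if m == n then b else 0).
  apply/series_convP => //; first exact: XCC.
  move=> eps eps0; exists 0%N => N _ t.
  rewrite big1 ?subrr ?normr0 ?ltW// => m _.
  by case: eqVneq => [->|_]; rewrite ?en0 ?mulr0 ?mul0r.
have := series_conv_unique X0 (H 0) (H 1) => /(congr1 (@^~ n)).
by rewrite eqxx => /esym/eqP; rewrite oner_eq0.
Qed.

(** [open_mapping] is iterated on the remainders, which halve at each step. The coefficients of the
    approximants add up to an expansion of [x] with controlled sums, and uniqueness identifies it
    with the given one. *)
Lemma basis_bound : exists2 K : R, 0 < K & forall x a rho, X x ->
  series_conv x e a -> 0 < rho -> (forall t, `|x t| <= rho) ->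
  forall s, uniq s -> forall t, `|\sum_(n <- s) a n * e n t| <= K * rho.
Proof.
have [Q Q0 QP] := open_mapping.
exists (2 * Q + 1) => [|x a0 rho Xx xa0 rho0 xrho]; first lra.
have step (p : R * fn R) : exists q : fn R * (nat -> R),
    0 < p.1 -> X p.2 -> (forall t, `|p.2 t| <= p.1) ->
    [/\ X q.1, series_conv q.1 e q.2,
    (forall s, uniq s -> forall t, `|\sum_(n <- s) q.2 n * e n t| <= Q * p.1) &
    forall t, `|p.2 t - q.1 t| <= p.1 / 2].
  case: p => r y /=.
  have [[r0 [Xy yr]]|nH] := pselect (0 < r /\ X y /\ forall t, `|y t| <= r).
    by have [z [a zP]] := QP r y r0 Xy yr; exists (z, a).
  by exists (fun=> 0, fun=> 0) => *; exfalso; apply: nH.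
have [F FP] := choice step.
pose r j : R := rho * 2^-1 ^+ j.
have r0 j : 0 < r j by rewrite mulr_gt0// half_pow_gt0.
pose fix xs j : fn R := if j is i.+1 then
  (fun t => (-1) * (F (r i, xs i)).1 t + xs i t) else x.
pose ys j := (F (r j, xs j)).1.
pose as_ j := (F (r j, xs j)).2.
have rS j : r j.+1 = r j / 2 by rewrite /r exprSr; ring.
have inv j : X (xs j) /\ forall t, `|xs j t| <= r j.
  elim: j => [|j [IH1 IH2]]; first by split=> // t; rewrite /r expr0 mulr1.
  have [Xy _ _ H] := FP (r j, xs j) (r0 j) IH1 IH2; split; first exact: Xlin.
  by move=> t /=; rewrite mulN1r addrC rS; exact: H.
have yP j : [/\ X (ys j), series_conv (ys j) e (as_ j) &
    forall s, uniq s -> forall t, `|\sum_(n <- s) as_ j n * e n t| <= Q * r j].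
  by have [i1 i2] := inv j; have [] := FP (r j, xs j) (r0 j) i1 i2; split.
(* Coefficients of the sum of the first [J] approximants, that is, of [x - xs J]. *)
pose c J n := \sum_(j < J) as_ j n.
have cS J n : c J.+1 n = c J n + as_ J n by rewrite /c big_ord_recr.
have cB s J J' t : uniq s -> (J <= J')%N ->
    `|\sum_(n <- s) (c J' n - c J n) * e n t| <= 2 * Q * (r J - r J').
  move=> us /subnK <-; elim: (J' - J)%N => [|k IH].
    by rewrite add0n subrr mulr0 big1 ?normr0// => n _; rewrite subrr mul0r.
  rewrite addSn rS; have [_ _ /(_ s us t)] := yP (k + J)%N; move: IH.
  have -> : \sum_(n <- s) (c (k + J).+1 n - c J n) * e n t =
     \sum_(n <- s) (c (k + J)%N n - c J n) * e n t
     + \sum_(n <- s) as_ (k + J)%N n * e n t.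
    by rewrite -big_split; apply: eq_bigr => n _ /=; rewrite cS; ring.
  by rewrite !ler_norml; lra.
have cB' s J J' t : uniq s -> (J <= J')%N ->
    `|\sum_(n <- s) (c J' n - c J n) * e n t| <= 2 * Q * r J.
  move=> us JJ; apply: (le_trans (cB s J J' t us JJ)).
  by apply: ler_wpM2l; [lra|have := r0 J'; lra].
have rsmall eps : 0 < eps -> exists J, r J <= eps.
  move=> eps0; have [|J JP] := @half_pow_small R (eps / rho).
    by rewrite divr_gt0.
  by exists J; rewrite /r mulrC -ler_pdivlMr.
(* Each coefficient converges: apply [cB'] to the singleton of [n] at a point where [e n] does not
   vanish. *)
have /choice[a aP] : forall n, exists l, forall eps : R, 0 < eps ->
    exists N, forall j, (N <= j)%N -> `|l - c j n| <= eps.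
  move=> n.
  have [t ent] := basis_nz n; have et0 : 0 < `|e n t| by rewrite normr_gt0.
  apply: real_complete => eps eps0.
  have [|J JP] := rsmall (eps * `|e n t| / (4 * Q + 1)).
    by rewrite divr_gt0 ?mulr_gt0//; lra.
  exists J => i j Ji Jj.
  have := cB' [:: n] J i t isT Ji; have := cB' [:: n] J j t isT Jj.
  rewrite !big_seq1 !normrM => H1 H2.
  have H3 : `|c i n - c j n| <= `|c i n - c J n| + `|c j n - c J n|.
    by rewrite (_ : c i n - c j n = (c i n - c J n) - (c j n - c J n)) ?ler_normB//; ring.
  rewrite -(ler_pM2r et0); rewrite ler_pdivlMr in JP; last lra.
  have := ler_wpM2r (ltW et0) H3; have := r0 J; lra.
have aB s J t : uniq s -> `|\sum_(n <- s) (a n - c J n) * e n t| <= 2 * Q * r J.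
  move=> us; apply/ler_addgt0Pr => eps eps0.
  have [N NP] := sum_approx (e ^~ t) s aP eps0.
  have := NP (maxn N J) (leq_maxl _ _).
  have := cB' s J (maxn N J) t us (leq_maxr _ _).
  have -> : \sum_(n <- s) (a n - c J n) * e n t =
    \sum_(n <- s) (a n - c (maxn N J) n) * e n t +
    \sum_(n <- s) (c (maxn N J) n - c J n) * e n t.
    by rewrite -big_split; apply: eq_bigr => n _ /=; ring.
  by rewrite !ler_norml; lra.
have cconv J : series_conv (fun t => x t - xs J t) e (c J).
  elim: J => [|J IH].
    rewrite (_ : c 0%N = fun=> 0); last by apply/funext => n; rewrite /c big_ord0.
    apply: series_conv_eq (@series_conv_fin _ e [::] (fun=> 0) Ce isT) => // t.
    by rewrite /= big_nil subrr.
  have [Xy ya _] := yP J; have [Xs _] := inv J.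
  apply: series_conv_eq
    (series_conv_lin 1 (XCC Xy) (CCB (XCC Xx) (XCC Xs)) Ce ya IH) => [t|n] /=.
    by rewrite -/(ys J); ring.
  by rewrite cS; ring.
(* The error splits into the remainder [xs J], the tail of the series for [x - xs J], and the sums
   of [a - c J]. The first and third are small uniformly in the length of the sum once [J] is fixed
   large. *)
have xa : series_conv x e a.
  apply/series_convP => //; first exact: XCC.
  move=> eps eps0.
  have [|J JP] := rsmall (eps / 2 / (1 + 2 * Q)); first by rewrite !divr_gt0//; lra.
  have {}JP : r J + 2 * Q * r J <= eps / 2.
    by rewrite ler_pdivlMr in JP; lra.
  have [Xs xsB] := inv J.
  have [|N0 N0P] := (series_convP _ (CCB (XCC Xx) (XCC Xs)) Ce).1 (cconv J) (eps / 2).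
    by rewrite divr_gt0.
  exists N0 => N /N0P /[swap] t /(_ t) H1.
  have H2 := aB (index_iota 0 N) J t (iota_uniq _ _); have H3 := xsB t.
  move: H2; rewrite big_mkord.
  have -> : \sum_(n < N) (a n - c J n) * e n t =
     \sum_(n < N) a n * e n t - \sum_(n < N) c J n * e n t.
    by rewrite -sumrB; apply: eq_bigr => n _; ring.
  by move: H1 H3; rewrite !ler_norml; lra.
rewrite (series_conv_unique Xx xa0 xa) => s us t.
have := aB s 0%N t us; rewrite /r expr0 mulr1.
under eq_bigr do rewrite /c big_ord0 subr0.
move=> H; apply: (le_trans H); nra.
Qed.

Lemma basis_unc_const : exists2 K : R, 1 <= K & unc_const K e.
Proof.
have [K K0 KP] := basis_bound.
exists (K + 1); first lra.
suff : unc_const K e by apply: unc_const_le; lra.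
move=> s p a M us sM t; rewrite -big_filter.
apply/ler_addgt0Pr => eps eps0.
have Xs : X (fun t => \sum_(n <- s) a n * e n t).
  elim: (s) => [|n s' IH]; first by under eq_fun do rewrite big_nil.
  by under eq_fun do rewrite big_cons; exact: Xlin.
have M0 : 0 <= M by apply: le_trans (sM point).
(* [basis_bound] asks for a positive radius, while [M] may be 0; the extra [eps / K] costs only
   [eps]. *)
have := KP _ _ (M + eps / K) Xs (series_conv_fin a Ce us) _ _ _ (filter_uniq p us) t.
rewrite big_seq (eq_bigr (fun n => a n * e n t)) -?big_seq; last first.
  by move=> n; rewrite mem_filter => /andP[_ ->].
rewrite mulrDr mulrCA divff ?gt_eqF// mulr1; apply.
  by rewrite ltr_wpDl// divr_gt0.
move=> u; apply: (le_trans (sM u)); rewrite lerDl divr_ge0 ?ltW//.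
Qed.

End UnconditionalConstant.

Lemma normalized_basis (R : realType) (X : set (fn R)) :
  closed_subspace X -> has_uncond_basis X ->
  exists (e : nat -> fn R) (K : R) (co : fn R -> nat -> R),
    [/\ (forall n, X (e n)) /\ (forall n, exists t, 2 <= `|e n t|),
      1 <= K, unc_const K e,
      (forall c x y n, X x -> X y ->
         co (fun t => c * x t + y t) n = c * co x n + co y n) &
      (forall x, X x -> forall eps : R, 0 < eps -> exists N0, forall N, (N0 <= N)%N ->
         forall t, `|x t - \sum_(n < N) co x n * e n t| <= eps)].
Proof.
move=> sX [e [Xe eP]].
have [XCC _ Xlin _] := sX.
have Ce n : CC (e n) by apply: XCC.
have [K K1 eK] := basis_unc_const sX Xe eP.
have /choice[u uP] := basis_nz sX Xe eP.
have /choice[co coP] : forall x, exists a, X x -> series_conv x e a.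
  move=> x; have [/eP[[a [xa _]] _]|nXx] := pselect (X x); first by exists a.
  by exists (fun=> 0).
(* Modulus 2 rather than 1, so that a nearby dense function still reaches modulus 1. *)
pose m n : R := 2 / `|e n (u n)|.
have m0 n : 0 < m n by rewrite divr_gt0// normr_gt0.
exists (fun n t => m n * e n t), K, (fun x n => co x n / m n); split=> //.
- split=> n.
    have := Xlin (m n) _ _ (Xe n) (_ : X (fun=> 0)); have [_ X0 _ _] := sX.
    by move=> /(_ X0); under eq_fun do rewrite addr0.
  by exists (u n); rewrite normrM gtr0_norm// divfK// normr_eq0.
- move=> s p a M us sM t.
  have key (q : pred nat) v : \sum_(n <- s | q n) a n * (m n * e n v) =
      \sum_(n <- s | q n) (a n * m n) * e n v.
    by apply: eq_bigr => n _; rewrite mulrA.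
  by rewrite key; apply: (eK s p (fun n => a n * m n)) => // v; rewrite -key.
- move=> c x y n Xx Xy.
  have Xz := Xlin c _ _ Xx Xy.
  have H := series_conv_lin c (XCC _ Xx) (XCC _ Xy) Ce (coP x Xx) (coP y Xy).
  by rewrite (series_conv_unique eP Xz (coP _ Xz) H) mulrDl mulrA.
- move=> x Xx eps eps0.
  have [N0 N0P] := (series_convP _ (XCC _ Xx) Ce).1 (coP x Xx) eps eps0.
  exists N0 => N /N0P + t => /(_ t); congr (`| _ - _| <= _).
  by apply: eq_bigr => n _; rewrite mulrA divfK// gt_eqF.
Qed.

(** * The amalgam *)

Section Amalgam.
Variables (R : realType) (d : nat -> fn R) (dt : nat -> cantor_space).
Variable rel : nat -> nat -> bool.
Hypothesis Cd : forall n, CC (d n).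
Hypothesis dt0 : forall n, d n (dt n) != 0.
Hypothesis relxx : forall n, rel n n.
Hypothesis rel_sym : forall m n, rel m n = rel n m.

(** One point of the Cantor set codes a pair, a set of nodes and a point, so the amalgam lives in
    the same $C(2^{\mathbb{N}})$. *)
Definition evens (tau : cantor_space) : nat -> bool := fun n => tau n.*2.
Definition odds (tau : cantor_space) : cantor_space := fun n => tau n.*2.+1.
Definition merge (chi : pred nat) (t : cantor_space) : cantor_space :=
  fun k => if odd k then t k./2 else chi k./2.

(* Greedy choice of a clique of [rel] inside the set coded by [evens tau]. *)
Definition clique tau n := evens tau n &&
  all (fun m => evens tau m ==> rel m n) (iota 0 n).

Definition amalg n : fn R := fun tau => if clique tau n then d n (odds tau) else 0.

Definition restr (p : pred nat) (tau : cantor_space) : cantor_space :=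
  merge (fun n => clique tau n && p n) (odds tau).

Lemma evens_merge (chi : pred nat) t : evens (merge chi t) = chi.
Proof. by apply/funext => n; rewrite /evens /merge odd_double doubleK. Qed.

Lemma odds_merge (chi : pred nat) t : odds (merge chi t) = t.
Proof. by apply/funext => n; rewrite /odds /merge /= odd_double /= uphalf_double. Qed.

Lemma clique_rel tau m n : clique tau m -> clique tau n -> rel m n.
Proof.
wlog mn : m n / (m <= n)%N.
  move=> H cm cn; case: (leqP m n) => [mn|/ltnW nm]; first exact: H.
  by rewrite rel_sym; exact: H.
move: mn; rewrite leq_eqVlt => /predU1P[->|mn]//.
move=> /andP[em _] /andP[_ /allP/(_ m)]; rewrite mem_iota /= => /(_ mn).
by rewrite em.
Qed.

Lemma clique_merge (chi : pred nat) t : (forall m n, chi m -> chi n -> rel m n) ->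
  clique (merge chi t) =1 chi.
Proof.
move=> chiP n; rewrite /clique evens_merge; case: (boolP (chi n)) => //= cn.
by apply/allP => m _; apply/implyP => cm; exact: chiP.
Qed.

Lemma clique_restr p tau n : clique (restr p tau) n = clique tau n && p n.
Proof.
rewrite clique_merge// => i j /andP[ci _] /andP[cj _]; exact: clique_rel ci cj.
Qed.

Lemma odds_restr p tau : odds (restr p tau) = odds tau.
Proof. exact: odds_merge. Qed.

Lemma restr_restr p q tau : restr p (restr q tau) = restr (predI q p) tau.
Proof.
rewrite {1}/restr odds_restr /restr; congr merge.
by apply/funext => n; rewrite -/(restr q tau) clique_restr -andbA.
Qed.

Lemma eq_restr p q tau : (forall n, clique tau n -> p n = q n) ->
  restr p tau = restr q tau.
Proof.
move=> pq; rewrite /restr; congr merge; apply/funext => n.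
by case: (boolP (clique tau n)) => //= /pq ->.
Qed.

Lemma amalg_restr p n tau : amalg n (restr p tau) = if p n then amalg n tau else 0.
Proof. by rewrite /amalg clique_restr odds_restr; case: clique; case: (p n). Qed.

(** Membership of [n] looks only at nodes up to [n], hence at finitely many digits; this is what
    makes [amalg n] continuous. *)
Lemma agree_clique tau tau' n : agree n.*2.+1 tau tau' -> clique tau n = clique tau' n.
Proof.
move=> tt; have E m : (m <= n)%N -> evens tau m = evens tau' m.
  by move=> mn; apply: tt; rewrite ltnS leq_double.
rewrite /clique E//; congr (_ && _); apply: eq_in_all => m.
by rewrite mem_iota /= add0n => /ltnW/E ->.
Qed.

Lemma agree_odds tau tau' n : agree n.*2 tau tau' -> agree n (odds tau) (odds tau').
Proof. by move=> tt m mn; apply: tt; lia. Qed.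

Lemma CC_amalg n : CC (amalg n).
Proof.
apply: CC_of => eps eps0; have [k kP] := CC_unif (@Cd n) eps0.
exists (maxn n.*2.+1 k.*2) => tau tau' tt.
rewrite /amalg -(@agree_clique tau); last by apply: agreeW tt; exact: leq_maxl.
case: ifP => _; last by rewrite subrr normr0 ltW.
by apply: kP; apply: agree_odds; apply: agreeW tt; exact: leq_maxr.
Qed.

(** Here the clique is the single node [n], so every [amalg m] with [m != n] vanishes and
    evaluation, suitably scaled, is the coordinate functional [coef n]. *)
Definition node_pt n : cantor_space := merge (pred1 n) (dt n).

Lemma clique_node_pt n : clique (node_pt n) =1 pred1 n.
Proof. by apply: clique_merge => i j /eqP -> /eqP ->. Qed.

Lemma amalg_node_pt m n : amalg m (node_pt n) = if m == n then d n (dt n) else 0.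
Proof.
by rewrite /amalg clique_node_pt /= odds_merge; case: eqVneq => [->|].
Qed.

Definition coef n (x : fn R) : R := x (node_pt n) / d n (dt n).

Lemma coef_lin n c x y : coef n (fun t => c * x t + y t) = c * coef n x + coef n y.
Proof. by rewrite /coef mulrDl mulrA. Qed.

Lemma coef_amalg m n : coef m (amalg n) = (n == m)%:R.
Proof.
by rewrite /coef amalg_node_pt; case: eqVneq => _; rewrite ?mul0r// divff.
Qed.

(* The closed span of the functions [amalg n]: restriction to a set [p] of
   nodes acts on it as the coordinate projection onto [p]. *)
Definition amalgam : set (fn R) := [set x | [/\ CC x,
  (forall s : seq nat, uniq s -> forall tau,
     x (restr (mem s) tau) = \sum_(n <- s) coef n x * amalg n tau) &
  (forall eps : R, 0 < eps -> exists N, forall tau,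
     `|x tau - x (restr [pred n | (n < N)%N] tau)| <= eps)]].

Lemma amalgam_CC x : amalgam x -> CC x. Proof. by case. Qed.

Lemma amalgam_amalg n : amalgam (amalg n).
Proof.
split; first exact: CC_amalg.
- move=> s us tau; rewrite amalg_restr.
  under eq_bigr do rewrite coef_amalg.
  rewrite (_ : (if _ then _ else _) = if n \in s then amalg n tau else 0)//.
  case: (boolP (n \in s)) => ns.
    rewrite (bigD1_seq n)//= eqxx mul1r big1 ?addr0// => m mn.
    by rewrite eq_sym (negbTE mn) mul0r.
  rewrite big_seq big1// => m ms; case: eqVneq => [E|]; last by rewrite mul0r.
  by rewrite E ms in ns.
- move=> eps eps0; exists n.+1 => tau.
  by rewrite amalg_restr /= ltnSn subrr normr0 ltW.
Qed.

Lemma amalgam_lin c x y : amalgam x -> amalgam y -> amalgam (fun t => c * x t + y t).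
Proof.
move=> [Cx x1 x2] [Cy y1 y2]; split; first exact: CC_lin.
- move=> s us tau; rewrite x1// y1// mulr_sumr -big_split.
  by apply: eq_bigr => n _; rewrite coef_lin /=; ring.
- move=> eps eps0; have c0 : 0 < `|c| + 1 by rewrite ltr_wpDl.
  pose r1 N := restr [pred n | (n < N)%N].
  (* [x] and [y] need a common cutoff. Raising a cutoff at most doubles the error, because the
     smaller restriction factors through the larger. *)
  have mono (z : fn R) (e0 : R) N N' : (forall tau, `|z tau - z (r1 N tau)| <= e0) ->
      (N <= N')%N -> forall tau, `|z tau - z (r1 N' tau)| <= 2 * e0.
    move=> zN NN tau.
    have := zN (r1 N' tau); have := zN tau.
    have -> : r1 N (r1 N' tau) = r1 N tau.
      rewrite /r1 restr_restr; apply: eq_restr => n _ /=.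
      by case: ltnP => [H1|H1]; case: ltnP => [H2|H2] //=; lia.
    by rewrite !ler_norml; lra.
  have [|N3 N3P] := x2 (eps / 4 / (`|c| + 1)); first by rewrite !divr_gt0.
  have [|N4 N4P] := y2 (eps / 4); first by rewrite divr_gt0.
  exists (maxn N3 N4) => tau.
  have H1 := mono _ _ _ _ N3P (leq_maxl N3 N4) tau.
  have H2 := mono _ _ _ _ N4P (leq_maxr N3 N4) tau.
  rewrite -/(r1 (maxn N3 N4)).
  rewrite (_ : _ - _ = c * (x tau - x (r1 (maxn N3 N4) tau)) +
    (y tau - y (r1 (maxn N3 N4) tau))); last by ring.
  rewrite (le_trans (ler_normD _ _))// (splitr eps) lerD//; last lra.
  rewrite normrM; move: H1; rewrite mulrA ler_pdivlMr// => H1.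
  have := normr_ge0 c; have := normr_ge0 (x tau - x (r1 (maxn N3 N4) tau)).
  nra.
Qed.

Lemma amalgam0 : amalgam (fun=> 0).
Proof.
split; first exact: CC0.
- by move=> s us tau; rewrite big1// => n _; rewrite /coef !mul0r.
- by move=> eps eps0; exists 0%N => tau; rewrite subrr normr0 ltW.
Qed.

Lemma amalgam_sum (I : Type) (s : seq I) (a : I -> R) (x : I -> fn R) :
  (forall i, amalgam (x i)) -> amalgam (fun t => \sum_(i <- s) a i * x i t).
Proof.
move=> xA; elim: s => [|i s IH].
  by under eq_fun do rewrite big_nil; exact: amalgam0.
by under eq_fun do rewrite big_cons; exact: amalgam_lin.
Qed.

Lemma coef_sum n (I : Type) (s : seq I) (a : I -> R) (x : I -> fn R) :
  coef n (fun t => \sum_(i <- s) a i * x i t) = \sum_(i <- s) a i * coef n (x i).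
Proof. by rewrite /coef mulr_suml; apply: eq_bigr => i _; rewrite mulrA. Qed.

Lemma amalgam_closed f : CC f ->
  (forall eps : R, 0 < eps -> exists2 g, amalgam g & forall t, `|f t - g t| <= eps) ->
  amalgam f.
Proof.
move=> Cf fg; split=> //.
- move=> s us tau; apply/eqP; rewrite -subr_eq0 -normr_le0.
  apply/ler_addgt0Pr => eps eps0; rewrite add0r.
  (* The identity involves one value at the restricted point and the values at the [node_pt n]; [B]
     is the total weight of these evaluations. *)
  pose B := 1 + \sum_(n <- s) `|amalg n tau / d n (dt n)|.
  have B0 : 0 < B by rewrite ltr_pwDl// sumr_ge0.
  have [|g gA gP] := fg (eps / B); first exact: divr_gt0.
  have [_ g1 _] := gA.
  rewrite (_ : _ - _ = (f (restr (mem s) tau) - g (restr (mem s) tau)) -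
     \sum_(n <- s) (f (node_pt n) - g (node_pt n)) * (amalg n tau / d n (dt n))); last first.
    rewrite [g (restr _ _)]g1// -addrA -opprD -big_split /=; congr (_ - _).
    by apply: eq_bigr => n _; rewrite /coef; field; exact: dt0.
  rewrite (le_trans (ler_normB _ _))//.
  have -> : eps = eps / B + \sum_(n <- s) eps / B * `|amalg n tau / d n (dt n)|.
    by rewrite -mulr_sumr -[X in X + _]mulr1 -mulrDr divfK// gt_eqF.
  rewrite lerD// (le_trans (ler_norm_sum _ _ _))//; apply: ler_sum => n _.
  by rewrite normrM ler_wpM2r.
- move=> eps eps0; have [|g gA gP] := fg (eps / 3); first by rewrite divr_gt0.
  have [_ _ /(_ (eps / 3))[|N NP]] := gA; first by rewrite divr_gt0.
  exists N => tau; have := NP tau; have := gP tau.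
  have := gP (restr [pred n | (n < N)%N] tau); rewrite !ler_norml; lra.
Qed.

Lemma amalgam_subspace : closed_subspace amalgam.
Proof.
split; [exact: amalgam_CC|exact: amalgam0|move=> *; exact: amalgam_lin|].
move=> f Cf fg; apply: amalgam_closed => // eps /fg[g gA /ltW fgeps].
exists g => // t; apply: le_trans fgeps.
by apply: (@supnorm_ub _ (fun t => f t - g t)); apply: CCB => //; exact: amalgam_CC.
Qed.

(** [tau] and its restriction to [s] become the same point when cut to the nodes below [N], all of
    which lie in [s]. Both values of [x] are thus close to a third one. *)
Lemma amalgam_tail x : amalgam x -> forall eps : R, 0 < eps -> exists N,
  forall s : seq nat, uniq s -> (forall n, (n < N)%N -> n \in s) -> forall tau,
    `|x tau - \sum_(n <- s) coef n x * amalg n tau| <= eps.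
Proof.
move=> [Cx x1 x2] eps eps0.
have [|N NP] := x2 (eps / 2); first by rewrite divr_gt0.
exists N => s us Ns tau; rewrite -x1//.
have := NP tau; have := NP (restr (mem s) tau).
rewrite restr_restr (_ : restr (predI _ _) tau = restr [pred n | (n < N)%N] tau).
  by rewrite !ler_norml; lra.
by apply: eq_restr => n _ /=; apply: andb_idl => /Ns.
Qed.

Lemma amalgam_basis : has_uncond_basis amalgam.
Proof.
exists amalg; split=> [|x xA]; first exact: amalgam_amalg.
have Cx := amalgam_CC xA.
have H s : CC (fun t => x t - \sum_(n <- s) coef n x * amalg n t).
  by apply: CCB => //; apply: CC_sum => n _; apply: CCZ; exact: CC_amalg.
have xu : uncond_conv x amalg (coef ^~ x).
  move=> eps eps0; have [|N NP] := amalgam_tail xA (_ : 0 < eps / 2).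
    by rewrite divr_gt0.
  by exists N => s us Ns; apply: (supnorm_lt (NP s us Ns)); lra.
have xs : series_conv x amalg (coef ^~ x).
  move=> eps /xu[N0 N0P]; exists N0 => N NN.
  under eq_fun do rewrite -(big_mkord xpredT (fun n => coef n x * amalg n _)).
  apply: N0P; first exact: iota_uniq.
  by move=> n nN; rewrite mem_index_iota /=; apply: leq_trans NN.
have uq a : series_conv x amalg a -> coef ^~ x = a.
  move=> /(series_convP _ Cx CC_amalg) xa; apply/funext => n.
  apply/eqP; rewrite /coef -(inj_eq (mulIf (dt0 n))) divfK// -subr_eq0 -normr_le0.
  apply/ler_addgt0Pr => eps /xa[N NP]; rewrite add0r.
  have := NP (maxn N n.+1) (leq_maxl _ _) (node_pt n).
  have nN : (n < maxn N n.+1)%N by exact: leq_maxr.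
  rewrite (bigD1 (Ordinal nN))//= amalg_node_pt eqxx big1 ?addr0// => m mn.
  by rewrite amalg_node_pt -val_eqE /= in mn *; rewrite (negbTE mn) mulr0.
split; first by exists (coef ^~ x); split.
by move=> a /uq <-.
Qed.

Lemma amalgam_clique_le x (s : seq nat) (M : R) t : amalgam x -> uniq s ->
  {in s &, forall m n, rel m n} -> (forall tau, `|x tau| <= M) ->
  `|\sum_(n <- s) coef n x * d n t| <= M.
Proof.
move=> [Cx x1 _] us sr xM.
have cl : clique (merge (mem s) t) =1 mem s by apply: clique_merge.
have := xM (restr (mem s) (merge (mem s) t)); rewrite x1//.
rewrite big_seq [X in _ -> `|X| <= _]big_seq.
under eq_bigr => n ns do rewrite /amalg cl /= ns odds_merge.
by [].
Qed.

End Amalgam.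

(** * Sequences equivalent to the basis of l_1 *)

Section L1Sequences.
Variable R : realType.
Implicit Types (u : nat -> fn R) (a b : nat -> R) (X : set (fn R)).

(** Equivalence with the unit vector basis of $\ell_1$, tested on finite sums; the lower estimate is
    witnessed at a point. *)
Definition l1_seq u (c C : R) := forall N b,
  (forall t, `|\sum_(i < N) b i * u i t| <= C * \sum_(i < N) `|b i|) /\
  exists t, c * \sum_(i < N) `|b i| <= `|\sum_(i < N) b i * u i t|.

Lemma l1norm_trunc N b :
  l1norm (fun n => if (n < N)%N then b n else 0) = (\sum_(i < N) `|b i|)%:E.
Proof.
rewrite /l1norm (nneseries_split 0 N); last by move=> k _; rewrite lee_fin.
rewrite add0n eseries0 ?adde0; last first.
  by move=> i Ni _; rewrite ltnNge Ni /= normr0.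
rewrite sumEFin -(big_mkord xpredT (fun i => `|b i|)); congr (_%:E).
by apply: eq_big_nat => i /andP[_ ->].
Qed.

Lemma l1_trunc N b : l1 (fun n => if (n < N)%N then b n else 0).
Proof. by rewrite /l1 /= l1norm_trunc ltry. Qed.

Lemma l1norm_partial a : l1 a ->
  (forall N, \sum_(i < N) `|a i| <= fine (l1norm a)) /\
  (forall eps : R, 0 < eps -> exists N0, forall N, (N0 <= N)%N ->
     fine (l1norm a) - eps <= \sum_(i < N) `|a i|).
Proof.
move=> la.
have l0 : (0 <= l1norm a)%E by apply: nneseries_ge0 => n _ _; rewrite lee_fin.
have lfin : l1norm a \is a fin_num by rewrite ge0_fin_numE.
have part N : (\sum_(0 <= i < N) (`|a i|)%:E = (\sum_(i < N) `|a i|)%:E)%E.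
  by rewrite sumEFin big_mkord.
split=> [N|eps eps0].
  rewrite -lee_fin fineK// -part; apply: nneseries_lim_ge => n _ _.
  by rewrite lee_fin.
apply: contrapT => /forallNP H.
have : (l1norm a <= (fine (l1norm a) - eps)%:E)%E.
  apply: lime_le; first by apply: is_cvg_nneseries => n _ _; rewrite lee_fin.
  apply: nearW => N; rewrite part lee_fin.
  have /existsNP[M /not_implyP[NM /negP]] := H N; rewrite -ltNge => /ltW.
  apply: le_trans; rewrite -!(big_mkord xpredT (fun i => `|a i|)).
  by rewrite (big_cat_nat (leq0n N) NM)//= lerDl sumr_ge0.
by rewrite -{1}(fineK lfin) lee_fin; lra.
Qed.

Lemma contains_l1_seq X : closed_subspace X -> contains_l1 X ->
  exists u c C, [/\ 0 < c, 0 <= C, forall i, X (u i) & l1_seq u c C].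
Proof.
move=> [XCC X0 Xlin _] [T [TX Tlin [c [C [c0 TP]]]]].
pose tr N b := fun n => if (n < N)%N then b n else 0 : R.
(* The image of the [i]-th unit vector, written as a truncation so that its membership in [l1] is
   immediate. *)
pose u i := T (tr i.+1 (fun n => (n == i)%:R)).
have uX i : X (u i) by apply: TX; exact: l1_trunc.
have T0 N : T (tr 0%N N) = fun=> 0.
  have := Tlin (-1) _ _ (l1_trunc 0 N) (l1_trunc 0 N).
  rewrite -/(tr 0%N N) (_ : (fun n => _) = tr 0%N N).
    by move=> ->; apply/funext => t; ring.
  by apply/funext => n; rewrite /tr /= mulr0 addr0.
have TS N b : T (tr N b) = fun t => \sum_(i < N) b i * u i t.
  elim: N => [|N IH]; first by rewrite T0; apply/funext => t; rewrite big_ord0.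
  have -> : tr N.+1 b = fun n => b N * tr N.+1 (fun n => (n == N)%:R) n + tr N b n.
    apply/funext => n; rewrite /tr ltnS; case: (ltngtP n N) => [nN|nN|->].
    - by rewrite mulr0 add0r.
    - by rewrite mulr0 add0r.
    - by rewrite /= mulr1 addr0.
  rewrite Tlin; [|exact: l1_trunc..].
  by rewrite IH; apply/funext => t; rewrite big_ord_recr /= addrC.
have sup N b : c * \sum_(i < N) `|b i| <= supnorm (T (tr N b)) <= C * \sum_(i < N) `|b i|.
  by have := TP _ (l1_trunc N b); rewrite l1norm_trunc.
have C0 : 0 <= C.
  have := sup 1%N (fun=> 1); rewrite !big_ord1 normr1 !mulr1 => /andP[H1 H2].
  by apply: le_trans H2; apply: le_trans H1; exact: ltW.
exists u, c, C; split=> // N b; have /andP[H1 H2] := sup N b.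
have CT : CC (T (tr N b)) by apply: XCC; apply: TX; exact: l1_trunc.
split=> [t|].
  by apply: le_trans H2; have := supnorm_ub CT t; rewrite {1}TS.
have [t tP] := CC_attain (CC_norm CT).
exists t; apply: (le_trans H1); apply: supnorm_le => s.
by apply: (le_trans (tP s)); rewrite TS.
Qed.

(** The operator sends [a] to the uniform limit of its partial sums, which is Cauchy by the upper
    estimate; both estimates pass to the limit. *)
Lemma l1_seq_contains X u c C : closed_subspace X -> 0 < c -> 0 <= C ->
  (forall i, X (u i)) -> l1_seq u c C -> contains_l1 X.
Proof.
move=> sX c0 C0 uX uP; have [XCC X0 Xlin _] := sX.
have Cu i : CC (u i) by apply: XCC.
have XS N a : X (fun t => \sum_(i < N) a i * u i t).
  elim: N => [|N IH]; first by under eq_fun do rewrite big_ord0.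
  by under eq_fun do rewrite big_ord_recr /= addrC; exact: Xlin.
have /choice[T TP] : forall a, exists f, l1 a -> X f /\ forall eps : R, 0 < eps ->
    exists N0, forall N, (N0 <= N)%N ->
    forall t, `|f t - \sum_(i < N) a i * u i t| <= eps.
  move=> a; have [la|nla] := pselect (l1 a); last by exists (fun=> 0).
  have [S1 S2] := l1norm_partial la.
  have [|f [Cf fP]] := @CC_complete R (fun N t => \sum_(i < N) a i * u i t)
      (fun N => XCC _ (XS N a)).
    move=> eps eps0.
    have [|N0 N0P] := S2 (eps / 2 / (C + 1)); first by rewrite !divr_gt0//; lra.
    have key N t : (N0 <= N)%N ->
        `|\sum_(i < N) a i * u i t - \sum_(i < N0) a i * u i t| <= eps / 2.
      move=> NN; pose b i := if (i < N0)%N then 0 else a i.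
      have bE (F : nat -> R -> R) : (forall i, F i 0 = 0) ->
          \sum_(i < N) F i (b i) = \sum_(i < N) F i (a i) - \sum_(i < N0) F i (a i).
        move=> F0; rewrite -(big_mkord xpredT (fun i => F i (b i))) -!(big_mkord xpredT (fun i => F i (a i))).
        rewrite (big_cat_nat (leq0n N0) NN)//= [X in _ = X - _](big_cat_nat (leq0n N0) NN)//=.
        rewrite big_nat big1 ?add0r => [|i /andP[_ iN]]; last by rewrite /b iN F0.
        rewrite addrAC subrr add0r; apply: eq_big_nat => i /andP[Ni _].
        by rewrite /b ltnNge Ni.
      have [/(_ t) + _] := uP N b.
      rewrite (bE (fun i x => x * u i t)) => [|i]; last by rewrite mul0r.
      rewrite (bE (fun i x => `|x|)) => [|i]; last by rewrite normr0.
      move=> H; apply: (le_trans H).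
      have H1 := S1 N; have H2 := N0P N0 (leqnn _).
      apply: (@le_trans _ _ (C * (eps / 2 / (C + 1)))).
        by apply: ler_wpM2l => //; lra.
      rewrite mulrA ler_pdivrMr; [|lra]; nra.
    exists N0 => n m Nn Nm t; have := key n t Nn; have := key m t Nm.
    by rewrite !ler_norml; lra.
  exists f => _; split=> //; apply: (subspace_limit sX) => // eps /fP[N NP].
  by exists (fun t => \sum_(i < N) a i * u i t) => //; exact: NP.
exists T; split=> [a /TP[]//|r a b la lb|].
  have lab : l1 (fun n => r * a n + b n).
    rewrite /l1 /=; apply: (@le_lt_trans _ _ (`|r|%:E * l1norm a + l1norm b)%E).
      rewrite /l1norm -nneseriesZl => [|n _ //].
      rewrite -nneseriesD => [|n _ _|n _ _].
      - apply: lee_nneseries => n _; first by rewrite lee_fin.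
        by rewrite -EFinM -EFinD lee_fin -normrM ler_normD.
      - by rewrite -EFinM lee_fin mulr_ge0.
      - by rewrite lee_fin.
    by rewrite lte_add_pinfty// lte_mul_pinfty.
  have [_ T1] := TP _ la; have [_ T2] := TP _ lb; have [_ T3] := TP _ lab.
  apply/funext => t; apply/eqP; rewrite -subr_eq0 -normr_le0.
  apply/ler_addgt0Pr => eps eps0; rewrite add0r.
  have r0 : 0 < `|r| + 1 by rewrite ltr_wpDl.
  have [|N1 /(_ _ _ t) N1P] := T1 (eps / 3 / (`|r| + 1)); first by rewrite !divr_gt0.
  have [|N2 /(_ _ _ t) N2P] := T2 (eps / 3); first by rewrite divr_gt0.
  have [|N3 /(_ _ _ t) N3P] := T3 (eps / 3); first by rewrite divr_gt0.
  pose N := maxn N1 (maxn N2 N3).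
  have {}N1P := N1P N; have {}N2P := N2P N; have {}N3P := N3P N.
  have {}N1P := N1P (leq_maxl _ _).
  have {}N2P : `|T b t - \sum_(i < N) b i * u i t| <= eps / 3.
    by apply: N2P; rewrite /N !leq_max leqnn orbT.
  have {N3P} : `|T (fun n => r * a n + b n) t - \sum_(i < N) (r * a i + b i) * u i t|
       <= eps / 3 by apply: N3P; rewrite /N !leq_max leqnn !orbT.
  have -> : \sum_(i < N) (r * a i + b i) * u i t =
      r * \sum_(i < N) a i * u i t + \sum_(i < N) b i * u i t.
    by rewrite mulr_sumr -big_split; apply: eq_bigr => i _ /=; ring.
  have : `|r * (T a t - \sum_(i < N) a i * u i t)| <= eps / 3.
    rewrite normrM; rewrite ler_pdivlMr// in N1P.
    have := normr_ge0 (T a t - \sum_(i < N) a i * u i t); nra.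
  by move: N2P; rewrite !ler_norml; lra.
exists c, C; split=> // a la.
have [Xf fP] := TP _ la; have [S1 S2] := l1norm_partial la.
apply/andP; split.
  apply/ler_addgt0Pr => eps eps0.
  have [|N1 N1P] := fP (eps / 2); first by rewrite divr_gt0.
  have [|N2 N2P] := S2 (eps / 2 / c); first by rewrite !divr_gt0.
  have {}N1P := N1P (maxn N1 N2) (leq_maxl _ _).
  have {}N2P := N2P (maxn N1 N2) (leq_maxr _ _).
  have [_ [t tP]] := uP (maxn N1 N2) a.
  have H1 := N1P t; have H2 := supnorm_ub (XCC _ Xf) t.
  have H3 := ler_wpM2l (ltW c0) N2P.
  have H4 : c * (eps / 2 / c) = eps / 2 by field; rewrite gt_eqF.
  have H5 : `|\sum_(i < maxn N1 N2) a i * u i t| <= `|T a t| + eps / 2.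
    by move: H1; have := ler_norm (T a t); have := ler_norm (- T a t);
      rewrite normrN !ler_norml; lra.
  rewrite mulrBr in H3; lra.
apply: supnorm_le => t; apply/ler_addgt0Pr => eps eps0.
have [N NP] := fP eps eps0.
have [/(_ t) H _] := uP N a.
have H1 := NP N (leqnn _) t.
have H2 := ler_wpM2l C0 (S1 N).
move: H H1; rewrite !ler_norml; lra.
Qed.

(** [N.+1] vectors are linearly dependent in their first [N] coordinates; a dependence among those
    from index [M] on is normalised in $\ell_1$. *)
Lemma kill_coordinates (x : nat -> nat -> R) M N : exists b : nat -> R,
  [/\ forall i, (i < M)%N -> b i = 0, \sum_(i < M + N.+1) `|b i| = 1 &
    forall n, (n < N)%N -> \sum_(i < M + N.+1) b i * x n i = 0].
Proof.
pose A : 'M[R]_(N.+1, N) := \matrix_(i, n) x n (M + i)%N.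
have : kermx A != 0.
  rewrite kermx_eq0 /row_free; apply/negP => /eqP rA.
  by have := rank_leq_col A; rewrite rA ltnn.
move=> /rowV0Pn[v /sub_kermxP vA v0].
pose s := \sum_(i < N.+1) `|v 0 i|.
have s0 : 0 < s.
  rewrite lt_neqAle sumr_ge0// andbT eq_sym; apply: contra_neq v0 => /eqP.
  rewrite psumr_eq0// => /allP v0; apply/rowP => i; rewrite mxE.
  by have := v0 i; rewrite mem_index_enum normr_eq0 => /(_ isT)/eqP.
pose b i := if (i < M)%N then 0 else v 0 (inord (i - M)) / s.
have bE (F : nat -> R -> R) : (forall i, F i 0 = 0) ->
    \sum_(i < M + N.+1) F i (b i) = \sum_(i < N.+1) F (M + i)%N (v 0 i / s).
  move=> F0; rewrite big_split_ord /= big1 ?add0r => [|i _]; last first.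
    by rewrite /b ltn_ord F0.
  by apply: eq_bigr => i _; rewrite /b ltnNge leq_addr /= addKn inord_val.
exists b; split.
- by move=> i iM; rewrite /b iM.
- rewrite (bE (fun _ x => `|x|)) => [|i]; last by rewrite normr0.
  under eq_bigr do rewrite normrM.
  by rewrite -mulr_suml -/s gtr0_norm ?invr_gt0// divff// gt_eqF.
- move=> n nN; rewrite (bE (fun i y => y * x n i)) => [|i]; last by rewrite mul0r.
  have := congr1 (fun B : 'rV_N => B 0 (Ordinal nN)) vA; rewrite !mxE.
  under eq_bigr do rewrite mxE /=.
  move=> H; rewrite (eq_bigr (fun i : 'I__ => v 0 i * x n (M + i)%N / s)).
    by rewrite -mulr_suml H mul0r.
  by move=> i _; ring.
Qed.

End L1Sequences.

(** * Copies of l_1 in the amalgam *)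

Section L1Blocks.
Variables (R : realType) (Y : set (fn R)) (g : nat -> fn R) (co : nat -> fn R -> R).
Hypothesis Cg : forall n, CC (g n).
Hypothesis Ysum : forall N (a : nat -> R) (x : nat -> fn R), (forall i, Y (x i)) ->
  Y (fun t => \sum_(i < N) a i * x i t).
Hypothesis co_sum : forall n N (a : nat -> R) (x : nat -> fn R),
  co n (fun t => \sum_(i < N) a i * x i t) = \sum_(i < N) a i * co n (x i).
Hypothesis Ytail : forall x, Y x -> forall eps : R, 0 < eps -> exists N, forall N',
  (N <= N')%N -> forall t, `|x t - \sum_(n < N') co n x * g n t| <= eps.
Variable K : R.
Hypothesis gK : unc_const K g.

(** A gliding hump: $\ell_1$-normalised combinations over successive blocks of [u] with initial
    coordinates killed, then cut off where the tail is below [eps]. The blocks of [u] are disjoint,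
    so the lower estimate survives. *)
Lemma l1_seq_blocks u (c C eps : R) : 0 < eps -> (forall i, Y (u i)) -> l1_seq u c C ->
  exists (w : nat -> fn R) (N : nat -> nat),
  [/\ forall j, Y (w j), forall j t, `|w j t| <= C, forall j, (N j <= N j.+1)%N,
    (forall j t, `|w j t - \sum_(N j <= n < N j.+1) co n (w j) * g n t| <= eps) &
    forall (l : nat -> R) J, (forall j, 0 <= l j) ->
      exists t, c * \sum_(j < J) l j <= `|\sum_(j < J) l j * w j t|].
Proof.
move=> eps0 uY uP.
(* The state records how many vectors of [u] are used up and how many coordinates must vanish
   next. *)
have step (p : nat * nat) : exists q : (nat -> R) * nat,
  let w := fun t => \sum_(i < p.1 + p.2.+1) q.1 i * u i t in
  [/\ forall i, (i < p.1)%N -> q.1 i = 0, \sum_(i < p.1 + p.2.+1) `|q.1 i| = 1,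
     (p.2 <= q.2)%N &
    forall t, `|w t - \sum_(p.2 <= n < q.2) co n w * g n t| <= eps].
  case: p => M N /=.
  have [b [b0 b1 bk]] := kill_coordinates (fun n i => co n (u i)) M N.
  pose w := fun t => \sum_(i < M + N.+1) b i * u i t.
  have [N1 N1P] := Ytail (Ysum (M + N.+1) b uY) eps0.
  exists (b, maxn N N1); split=> //=; first exact: leq_maxl.
  move=> t; have := N1P _ (leq_maxr N N1) t.
  rewrite -(big_mkord xpredT (fun n => co n w * g n t)).
  have z : \sum_(0 <= n < N) co n w * g n t = 0.
    rewrite big_nat big1// => n /andP[_ nN].
    by rewrite /w co_sum bk ?mul0r.
  by rewrite (big_cat_nat (leq0n N) (leq_maxl N N1))/= z add0r.
have [F FP] := choice step.
pose fix st j : nat * nat := if j is i.+1 then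
  ((st i).1 + (st i).2.+1, (F (st i)).2)%N else (0, 0)%N.
pose M j := (st j).1; pose N j := (st j).2; pose b j := (F (st j)).1.
have MS j : M j.+1 = (M j + (N j).+1)%N by [].
pose w j : fn R := fun t => \sum_(i < M j.+1) b j i * u i t.
have bP j : [/\ forall i, (i < M j)%N -> b j i = 0,
    \sum_(i < M j.+1) `|b j i| = 1, (N j <= N j.+1)%N &
    forall t, `|w j t - \sum_(N j <= n < N j.+1) co n (w j) * g n t| <= eps].
  by have [? ? ? ?] := FP (st j); split.
exists w, N; split=> //.
- by move=> j; exact: Ysum.
- by move=> j t; have [/(_ t)] := uP (M j.+1) (b j); have [_ -> _ _] := bP j; rewrite mulr1.
- by move=> j; have [] := bP j.
- by move=> j; have [] := bP j.
move=> l J l0.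
(* The scaled block coefficients [l j * b j] concatenate to one sequence of $\ell_1$-norm
   [\sum l j]. *)
have [beta [betaE betaw]] : exists beta : nat -> R,
    \sum_(i < M J) `|beta i| = \sum_(j < J) l j /\
    forall t, \sum_(j < J) l j * w j t = \sum_(i < M J) beta i * u i t.
  elim: J => [|J [beta [IH1 IH2]]].
    by exists (fun=> 0); split=> [|t]; rewrite !big_ord0.
  exists (fun i => if (i < M J)%N then beta i else l J * b J i).
  have [b0 b1 _ _] := bP J.
  have split_sum (G : nat -> R -> R) : (forall i, G i 0 = 0) ->
      \sum_(i < M J.+1) G i (if (i < M J)%N then beta i else l J * b J i) =
      \sum_(i < M J) G i (beta i) + \sum_(i < M J.+1) G i (l J * b J i).
    move=> G0; rewrite MS !big_split_ord /=; congr (_ + _).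
      by apply: eq_bigr => i _; rewrite ltn_ord.
    rewrite [X in _ = X + _]big1 ?add0r => [|i _]; last by rewrite b0 ?mulr0.
    by apply: eq_bigr => i _; rewrite ltnNge leq_addr.
  split.
    rewrite (split_sum (fun _ x => `|x|)) => [|i]; last by rewrite normr0.
    rewrite IH1 big_ord_recr /=; congr (_ + _).
    by under eq_bigr do rewrite normrM ger0_norm//; rewrite -mulr_sumr b1 mulr1.
  move=> t; rewrite (split_sum (fun i x => x * u i t)) => [|i]; last by rewrite mul0r.
  rewrite big_ord_recr /= IH2 /w mulr_sumr; congr (_ + _).
  by apply: eq_bigr => i _; rewrite mulrA.
have [_ [t]] := uP (M J) beta; rewrite betaE => tP.
by exists t; rewrite betaw.
Qed.

Lemma l1_seq_point u (c C : R) : 0 < c -> 0 <= C -> (forall i, Y (u i)) -> l1_seq u c C ->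
  exists (w : nat -> fn R) (N : nat -> nat) t,
  [/\ forall j, Y (w j), forall j t, `|w j t| <= C, forall j, (N j <= N j.+1)%N &
    forall n, exists j, (n <= j)%N /\
      c / 8 <= \sum_(N j <= n < N j.+1) `|co n (w j) * g n t|].
Proof.
move=> c0 C0 uY uP; have c20 : 0 < c / 2 by lra.
have [w [N [wY wC NS wN wl]]] := l1_seq_blocks c20 uY uP.
pose G j : fn R := fun t => \sum_(N j <= n < N j.+1) `|co n (w j) * g n t|.
have GCC j : CC (G j).
  by apply: CC_sum => n _; apply: CC_norm; exact: CCZ.
have G0 j t : 0 <= G j t <= 2 * K * (C + c / 2).
  rewrite sumr_ge0//=; apply: (unc_const_abs t gK); first exact: iota_uniq.
  by move=> s; have := wN j s; have := wC j s; rewrite !ler_norml; lra.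
have wG j t : `|w j t| <= G j t + c / 2.
  have := wN j t.
  have := ler_norm_sum (index_iota (N j) (N j.+1)) (fun n => co n (w j) * g n t) xpredT.
  by rewrite -/(G j t) !ler_norml; lra.
(* A convex combination of the [G j] dominates, up to [c / 2], the modulus of the same combination
   of the [w j], which reaches [c] somewhere. Hence Simons applies at level [c / 2] and yields
   [c / 8]. *)
have [|t tP] := simons c20 GCC G0.
  move=> h hG.
  have [l [l0 [J0 lP]]] : exists l : nat -> R, (forall j, 0 <= l j) /\
      exists J0, forall J, (J0 <= J)%N -> \sum_(j < J) l j = 1 /\
        forall t, `|\sum_(j < J) l j * w j t| <= h t + c / 2.
    elim: hG => [j _|a h1 h2 a01 _ [l1 [l10 [J1 l1P]]] _ [l2 [l20 [J2 l2P]]]].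
      exists (fun i => (i == j)%:R); split=> //.
      exists j.+1 => J jJ; split=> [|t].
        rewrite (bigD1 (Ordinal jJ))//= eqxx big1 ?addr0// => i.
        by rewrite -val_eqE /= => /negbTE ->.
      rewrite (bigD1 (Ordinal jJ))//= eqxx mul1r big1 ?addr0// => i.
      by rewrite -val_eqE /= => /negbTE ->; rewrite mul0r.
    exists (fun i => a * l1 i + (1 - a) * l2 i); split=> [j|].
      by have := l10 j; have := l20 j; nra.
    exists (maxn J1 J2) => J; rewrite geq_max => /andP[/l1P[H1 B1] /l2P[H2 B2]].
    split=> [|t]; first by rewrite big_split -!mulr_sumr /= H1 H2; ring.
    have -> : \sum_(j < J) (a * l1 j + (1 - a) * l2 j) * w j t =
       a * \sum_(j < J) l1 j * w j t + (1 - a) * \sum_(j < J) l2 j * w j t.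
      by rewrite !mulr_sumr -big_split; apply: eq_bigr => j _ /=; ring.
    have := B1 t; have := B2 t; rewrite !ler_norml; nra.
  have [l1 lB] := lP J0 (leqnn _).
  have [t] := wl l J0 l0; rewrite l1 mulr1 => tP.
  by exists t; have := lB t; lra.
exists w, N, t; split=> // n.
by have [j [nj jP]] := tP n; exists j; split=> //; move: jP; rewrite /G; lra.
Qed.

End L1Blocks.

Section AmalgamL1.
Variables (R : realType) (d : nat -> fn R) (dt : nat -> cantor_space).
Variable rel : nat -> nat -> bool.
Hypothesis Cd : forall n, CC (d n).
Hypothesis dt0 : forall n, d n (dt n) != 0.
Hypothesis relxx : forall n, rel n n.
Hypothesis rel_sym : forall m n, rel m n = rel n m.

(* A copy of [l_1] in the amalgam lives, up to passing to blocks [S k], on a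
   single clique; [kap] records the block of a node. *)
Lemma amalgam_l1 : contains_l1 (amalgam d dt rel) ->
  exists (q : pred nat) (S : nat -> seq nat) (kap : nat -> nat) (v : nat -> R) c C t,
  [/\ 0 < c /\ 0 <= C, {in q &, forall m n, rel m n},
     forall k, uniq (S k) /\ forall n, n \in S k -> q n /\ kap n = k,
     (forall k s, `|\sum_(n <- S k) v n * d n s| <= C) &
     forall k, c <= \sum_(n <- S k) `|v n * d n t|].
Proof.
move=> /(contains_l1_seq (amalgam_subspace dt0 relxx rel_sym))[u [c [C [c0 C0 uY uP]]]].
(* Projecting a sum onto [p] amounts to evaluating it at the restricted point, so the constant is
   1. *)
have gK : unc_const 1 (amalg d rel).
  move=> s p a M us sM tau; rewrite mul1r.
  have := sM (restr rel p tau).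
  under eq_bigr do rewrite (amalg_restr d relxx rel_sym).
  rewrite [X in _ -> `|X| <= _]big_mkcond.
  by under eq_bigr do rewrite (fun_if ( *%R _)) mulr0.
have tl x : amalgam d dt rel x -> forall eps : R, 0 < eps -> exists N, forall N',
    (N <= N')%N -> forall t,
    `|x t - \sum_(n < N') coef d dt n x * amalg d rel n t| <= eps.
  move=> xY eps eps0; have [N NP] := amalgam_tail relxx rel_sym xY eps0.
  exists N => N' NN t; rewrite -(big_mkord xpredT (fun n => coef d dt n x * amalg d rel n t)).
  apply: NP; first exact: iota_uniq.
  by move=> n nN; rewrite mem_index_iota /=; apply: leq_trans NN.
have [|||w [N [tau [wY wC NS wP]]]] := @l1_seq_point R (amalgam d dt rel)
  (amalg d rel) (coef d dt) _ _ _ tl 1 gK u c C c0 C0 uY uP.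
- by move=> n; exact: CC_amalg.
- by move=> *; exact: amalgam_sum.
- by move=> *; exact: coef_sum.
have /choice[nxt nxtP] := wP.
(* A strictly increasing choice of blocks that are large at the one point [tau]. *)
pose fix phi k := if k is k'.+1 then nxt (phi k').+1 else nxt 0%N.
have phiS k : (phi k < phi k.+1)%N by have [] := nxtP (phi k).+1.
have phiG k : c / 8 <= \sum_(N (phi k) <= n < N (phi k).+1)
    `|coef d dt n (w (phi k)) * amalg d rel n tau|.
  by case: k => [|k]; [have [] := nxtP 0%N|have [] := nxtP (phi k).+1].
have phi_lt k k' : (k < k')%N -> (phi k < phi k')%N.
  elim: k' => // k' IH; rewrite ltnS leq_eqVlt => /predU1P[->//|/IH H].
  exact: ltn_trans H (phiS k').
have N_le i j : (i <= j)%N -> (N i <= N j)%N.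
  by move=> /subnK <-; elim: (j - i)%N => // k IH; apply: leq_trans IH (NS _).
pose q := clique rel tau.
pose S k := [seq n <- index_iota (N (phi k)) (N (phi k).+1) | q n].
have Sdisj k k' n : n \in S k -> n \in S k' -> k = k'.
  wlog kk : k k' / (k < k')%N.
    move=> H nk nk'; case: (ltngtP k k') => // kk; first exact: H nk nk'.
    by apply/esym; exact: H nk' nk.
  rewrite !mem_filter !mem_index_iota => /andP[_ /andP[_ H1]] /andP[_ /andP[H2 _]].
  by have := leq_trans H1 (leq_trans (N_le _ _ (phi_lt _ _ kk)) H2); rewrite ltnn.
have /choice[kap kapP] : forall n, exists k, forall k', n \in S k' -> k = k'.
  move=> n; have [[k nk]|nH] := pselect (exists k, n \in S k).
    by exists k => k'; exact: Sdisj.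
  by exists 0%N => k' nk'; exfalso; apply: nH; exists k'.
(* The sets [S k] are disjoint, so the coefficients of the different blocks glue to a single
   sequence. *)
pose v n := coef d dt n (w (phi (kap n))).
have Sv k (H : nat -> R -> R) :
    \sum_(n <- S k) H n (v n) = \sum_(n <- S k) H n (coef d dt n (w (phi k))).
  by rewrite big_seq [RHS]big_seq; apply: eq_bigr => n /kapP; rewrite /v => ->.
have Su k : uniq (S k) by rewrite filter_uniq// iota_uniq.
exists q, S, kap, v, (c / 8), C, (odds tau); split=> //.
- by split=> //; lra.
- by move=> m n; exact: clique_rel.
- move=> k; split=> // n nk; split; last exact: kapP.
  by move: nk; rewrite mem_filter => /andP[].
- move=> k s; rewrite (Sv k (fun n x => x * d n s)).
  apply: (amalgam_clique_le s (wY (phi k)) (Su k)); last exact: wC.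
  move=> m n; rewrite !mem_filter => /andP[qm _] /andP[qn _].
  exact: (clique_rel relxx rel_sym qm qn).
- move=> k; rewrite (Sv k (fun n x => `|x * d n (odds tau)|)).
  apply: le_trans (phiG k) _.
  rewrite big_filter [leRHS]big_mkcond; apply: ler_sum => n _.
  by rewrite /amalg /q; case: ifP; rewrite ?mulr0 ?normr0.
Qed.

End AmalgamL1.

(** * Coding the members of an analytic class *)

Section Embedding.
Variable R : realType.

(** [T] replaces [e n] by [h n] in the expansion of [x]: the two-sided comparison of finite sums
    gives convergence in [Y] and both norm estimates. The [h n] need not span [Y]. *)
Lemma equivalent_basis_embeds (X Y : set (fn R)) (e h : nat -> fn R)
    (co : fn R -> nat -> R) (B B' : R) :
  closed_subspace X -> closed_subspace Y -> 0 < B -> 0 < B' ->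
  (forall n, X (e n)) -> (forall n, Y (h n)) ->
  (forall c x y n, X x -> X y ->
     co (fun t => c * x t + y t) n = c * co x n + co y n) ->
  (forall x, X x -> forall eps : R, 0 < eps -> exists N0, forall N, (N0 <= N)%N ->
     forall t, `|x t - \sum_(n < N) co x n * e n t| <= eps) ->
  (forall (s : seq nat) (a : nat -> R) M, uniq s ->
     ((forall t, `|\sum_(n <- s) a n * e n t| <= M) ->
        forall t, `|\sum_(n <- s) a n * h n t| <= B * M) /\
     ((forall t, `|\sum_(n <- s) a n * h n t| <= M) ->
        forall t, `|\sum_(n <- s) a n * e n t| <= B' * M)) ->
  embeds X Y.
Proof.
move=> sX sY B0 B'0 eX hY colin xco eh.
have [XCC _ Xlin _] := sX; have [YCC Y0 Ylin _] := sY.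
have YS N (a : nat -> R) : Y (fun t => \sum_(i < N) a i * h i t).
  elim: N => [|N IH]; first by under eq_fun do rewrite big_ord0.
  by under eq_fun do rewrite big_ord_recr /= addrC; exact: Ylin.
have ord N (a : nat -> R) (k : nat -> fn R) t :
    \sum_(n < N) a n * k n t = \sum_(n <- index_iota 0 N) a n * k n t.
  by rewrite big_mkord.
have /choice[T TP] : forall x, exists f, X x -> Y f /\ forall eps : R, 0 < eps ->
    exists N0, forall N, (N0 <= N)%N ->
    forall t, `|f t - \sum_(n < N) co x n * h n t| <= eps.
  move=> x; have [Xx|nXx] := pselect (X x); last by exists (fun=> 0).
  have [|f [Cf fP]] := @CC_complete R (fun N t => \sum_(n < N) co x n * h n t)
      (fun N => YCC _ (YS N (co x))).
    move=> eps eps0.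
    have [|N0 N0P] := xco x Xx (eps / B / 4); first by rewrite !divr_gt0.
    have key N t : (N0 <= N)%N ->
        `|\sum_(n < N) co x n * h n t - \sum_(n < N0) co x n * h n t| <= eps / 2.
      move=> NN.
      have E (k : nat -> fn R) s : \sum_(n < N) co x n * k n s -
          \sum_(n < N0) co x n * k n s = \sum_(n <- index_iota N0 N) co x n * k n s.
        by rewrite !ord (big_cat_nat (leq0n N0) NN)/= addrAC subrr add0r.
      rewrite E (_ : eps / 2 = B * (eps / B / 2)); last by field; rewrite gt_eqF.
      apply: (eh (index_iota N0 N) (co x) (eps / B / 2) (iota_uniq _ _)).1 => s.
      rewrite -E; have := N0P _ NN s; have := N0P _ (leqnn _) s.
      by rewrite !ler_norml; lra.
    exists N0 => n m Nn Nm t; have := key n t Nn; have := key m t Nm.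
    by rewrite !ler_norml; lra.
  exists f => _; split=> //; apply: (subspace_limit sY) => // eps /fP[N NP].
  by exists (fun t => \sum_(n < N) co x n * h n t) => //; exact: NP.
exists T; split=> [x /TP[]//|r x y Xx Xy|].
  have Xz := Xlin r _ _ Xx Xy.
  have [_ T1] := TP _ Xx; have [_ T2] := TP _ Xy; have [_ T3] := TP _ Xz.
  apply/funext => t; apply/eqP; rewrite -subr_eq0 -normr_le0.
  apply/ler_addgt0Pr => eps eps0; rewrite add0r.
  have r0 : 0 < `|r| + 1 by rewrite ltr_wpDl.
  have [|N1 /(_ _ _ t) N1P] := T1 (eps / 3 / (`|r| + 1)); first by rewrite !divr_gt0.
  have [|N2 /(_ _ _ t) N2P] := T2 (eps / 3); first by rewrite divr_gt0.
  have [|N3 /(_ _ _ t) N3P] := T3 (eps / 3); first by rewrite divr_gt0.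
  pose N := maxn N1 (maxn N2 N3).
  have {}N1P := N1P N (leq_maxl _ _).
  have {}N2P : `|T y t - \sum_(i < N) co y i * h i t| <= eps / 3.
    by apply: N2P; rewrite /N !leq_max leqnn orbT.
  have {N3P} : `|T (fun t => r * x t + y t) t -
      \sum_(i < N) co (fun t => r * x t + y t) i * h i t| <= eps / 3.
    by apply: N3P; rewrite /N !leq_max leqnn !orbT.
  have -> : \sum_(i < N) co (fun t => r * x t + y t) i * h i t =
      r * \sum_(i < N) co x i * h i t + \sum_(i < N) co y i * h i t.
    rewrite mulr_sumr -big_split; apply: eq_bigr => i _ /=.
    by rewrite colin//; ring.
  have : `|r * (T x t - \sum_(i < N) co x i * h i t)| <= eps / 3.
    rewrite normrM; rewrite ler_pdivlMr// in N1P.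
    have := normr_ge0 (T x t - \sum_(i < N) co x i * h i t); nra.
  by move: N2P; rewrite !ler_norml; lra.
exists (B'^-1), B; split=> [|x Xx]; first by rewrite invr_gt0.
have [YT TxP] := TP _ Xx.
have xub := supnorm_ub (XCC _ Xx); have Tub := supnorm_ub (YCC _ YT).
have appr (eps : R) : 0 < eps -> exists N,
    (forall t, `|x t - \sum_(n < N) co x n * e n t| <= eps) /\
    (forall t, `|T x t - \sum_(n < N) co x n * h n t| <= eps).
  move=> eps0; have [N1 N1P] := xco x Xx eps eps0; have [N2 N2P] := TxP eps eps0.
  by exists (maxn N1 N2); split; [apply: N1P; exact: leq_maxl|apply: N2P; exact: leq_maxr].
apply/andP; split.
  rewrite mulrC ler_pdivrMr//; apply: supnorm_le => t.
  apply/ler_addgt0Pr => eps eps0; have B'1 : 0 < B' + 1 by lra.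
  have [|N [NP1 NP2]] := appr (eps / (B' + 1)); first by rewrite divr_gt0.
  have := (eh (index_iota 0 N) (co x) (supnorm (T x) + eps / (B' + 1)) (iota_uniq _ _)).2.
  have E : B' * (eps / (B' + 1)) + eps / (B' + 1) = eps by field; rewrite gt_eqF.
  move=> H; have {H} := H _ t; rewrite -!ord => H.
  have {H} : `|\sum_(n < N) co x n * e n t| <= B' * (supnorm (T x) + eps / (B' + 1)).
    apply: H => s; rewrite -ord; have := NP2 s; have := Tub s.
    by rewrite !ler_norml; lra.
  by have := NP1 t; rewrite !ler_norml mulrDr; lra.
apply: supnorm_le => t; apply/ler_addgt0Pr => eps eps0.
have B1 : 0 < B + 1 by lra.
have [|N [NP1 NP2]] := appr (eps / (B + 1)); first by rewrite divr_gt0.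
have := (eh (index_iota 0 N) (co x) (supnorm x + eps / (B + 1)) (iota_uniq _ _)).1.
have E : B * (eps / (B + 1)) + eps / (B + 1) = eps by field; rewrite gt_eqF.
move=> H; have {H} := H _ t; rewrite -!ord => H.
have {H} : `|\sum_(n < N) co x n * h n t| <= B * (supnorm x + eps / (B + 1)).
  apply: H => s; rewrite -ord; have := NP1 s; have := xub s.
  by rewrite !ler_norml; lra.
by have := NP2 t; rewrite !ler_norml mulrDr; lra.
Qed.

End Embedding.

Section Coding.
Variable R : realType.
Let D := @dense_fun R.

(* [i] codes a sequence of dense functions equivalent to a basic sequence lying
   in a member of [A]; it need not span that member. *)
Definition codes_basis (A : set (set (fn R))) (i : nat -> nat) := exists K : nat,
  [/\ (0 < K)%N, unc_const K%:R (D \o i), forall n, exists t, 1 <= `|D (i n) t| &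
    exists2 X, A X & forall n, exists2 x, X x &
      supnorm (fun t => x t - D (i n) t) < 2^-1 ^+ n / (4 * K%:R)].

Lemma C_open_ball (f : fn R) (r : R) : CC f ->
  C_open [set g : fn R | CC g /\ supnorm (fun t => g t - f t) < r].
Proof.
move=> Cf; split=> [g []//|g [Cg gr]].
exists (r - supnorm (fun t => g t - f t)); first by rewrite subr_gt0.
move=> k Ck kg; split=> //; move: kg; rewrite ltrBrDl; apply: le_lt_trans.
apply: supnorm_le => t.
have := supnorm_ub (CCB Cg Cf) t; have := supnorm_ub (CCB Ck Cg) t.
by rewrite !ler_norml; lra.
Qed.

(** Meeting a ball is an Effros-Borel condition, so its preimage under the parametrisation [f] is
    Borel and hence Suslin. The remaining conditions, for fixed [K], each concern finitely many
    entries of [i]. *)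
Lemma codes_basis_suslin (A : set (set (fn R))) : analytic_SB A -> suslin [set i | codes_basis A i].
Proof.
move=> [ASB [->|[f [fSB fB fA]]]].
  exists (fun _ _ => False); split=> [a b /(_ 0%N)[a' [b' []]]//|i].
  by split=> [[K [_ _ _ [X []]]]|[]].
pose U (p : nat * nat * nat) := [set g : fn R | CC g /\
  supnorm (fun t => g t - D p.1.1 t) < 2^-1 ^+ p.1.2 / (4 * p.2%:R)].
have /choice[F FP] : forall p, exists F : (nat -> nat) -> (nat -> nat) -> Prop,
    closed2 F /\ forall a, (f a `&` U p !=set0) <-> exists b, F a b.
  move=> p; have oU : C_open (U p) by apply: C_open_ball; exact: CC_dense_fun.
  have : baire_borel (f @^-1` [set X | SB X /\ X `&` U p !=set0]).
    by apply: fB => T [_ sT]; apply: sT; exists (U p).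
  move=> /baire_borel_suslin[F [cF FP]]; exists F; split=> // a.
  by rewrite -FP /=; split=> [|[]].
(* Row 0 stores the constant [K], row 1 the parameter of the member of [A], and row [n.+2] a witness
   that this member meets the [n]-th ball. *)
pose Z i rho := let K := row rho 0 0 in
  [/\ (0 < K)%N, unc_const K%:R (D \o i), forall n, exists t, 1 <= `|D (i n) t| &
    forall n, F (i n, n, K) (row rho 1) (row rho n.+2)].
exists Z; split.
  move=> i rho H.
  (* Only approximants agreeing with [rho] in the entry that stores [K] are used, so all conditions
     refer to one constant. *)
  have {}H N : exists i' rho', [/\ agree N i i', agree N rho rho',
      row rho' 0 0 = row rho 0 0 & Z i' rho'].
    have [N0 N0P] := agree_row 0 1 rho.
    have [i' [rho' [ii rr Zi]]] := H (maxn N N0).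
    exists i', rho'; split=> //.
    - by apply: agreeW ii; exact: leq_maxl.
    - by apply: agreeW rr; exact: leq_maxl.
    - by apply/esym/N0P => //; apply: agreeW rr; exact: leq_maxr.
  split.
  - by have [i' [rho' [_ _ <- []]]] := H 0%N.
  - move=> s p a M us.
    have [i' [rho' [ii _ <- [_ + _ _]]]] := H (\max_(n <- s) n).+1.
    move=> /(_ s p a M us).
    have E n t : n \in s -> (D \o i') n t = (D \o i) n t.
      by move=> ns; rewrite /= (ii n)// ltnS (big_rem n)//= leq_maxl.
    have E' (q : pred nat) t : \sum_(n <- s | q n) a n * (D \o i') n t =
        \sum_(n <- s | q n) a n * (D \o i) n t.
      rewrite big_seq_cond [RHS]big_seq_cond.
      by apply: eq_bigr => n /andP[ns _]; rewrite E.
    by move=> H1 H2 t; rewrite -E'; apply: H1 => u; rewrite E'.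
  - move=> n; have [i' [rho' [ii _ _ [_ _ + _]]]] := H n.+1.
    by move=> /(_ n); rewrite ii.
  - move=> n; have [cF _] := FP (i n, n, row rho 0 0); apply: cF => m.
    have [N1 N1P] := agree_row 1 m rho; have [N2 N2P] := agree_row n.+2 m rho.
    have [i' [rho' [ii rr rK [_ _ _ /(_ n) Fn]]]] := H (maxn n.+1 (maxn N1 N2)).
    exists (row rho' 1), (row rho' n.+2); split.
    + by apply: N1P; apply: agreeW rr; rewrite !leq_max leqnn orbT.
    + by apply: N2P; apply: agreeW rr; rewrite !leq_max leqnn !orbT.
    + by rewrite ii ?leq_max ?leqnn// -rK.
move=> i; split=> [[K [K0 iK i1 [X]]]|[rho [K0 iK i1 iF]]]; last first.
  exists (row rho 0 0); split=> //; exists (f (row rho 1)); first by rewrite -fA; exists (row rho 1).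
  move=> n; have [_ /(_ (row rho 1))[_ H]] := FP (i n, n, row rho 0 0).
  by have [|x [fx [_ xU]]] := H; [exists (row rho n.+2)|exists x].
rewrite -fA => -[al _ <-] alP.
have /choice[be beP] : forall n, exists b, F (i n, n, K) al b.
  move=> n; have [_ /(_ al)[H _]] := FP (i n, n, K); apply: H.
  have [x fx xU] := alP n; exists x; split=> //; split=> //.
  by have [+ _ _ _] := fSB al; apply.
exists (unrow (fun n => if n is n'.+1 then if n' is n''.+1 then be n'' else al
  else fun=> K)).
by split; rewrite ?rowK// => n; rewrite !rowK.
Qed.

Lemma basis_codes (A : set (set (fn R))) X : A X -> closed_subspace X -> has_uncond_basis X ->
  exists i (K K0 : R) (e : nat -> fn R) (co : fn R -> nat -> R), [/\ codes_basis A i,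
    [/\ 0 < K0, 0 < K, unc_const K0 e, unc_const K (D \o i) &
      forall n t, `|D (i n) t - e n t| <= 2^-1 ^+ n / (4 * K0)],
    (forall n, X (e n)) /\ (forall n, exists t, 1 <= `|e n t|),
    (forall c x y n, X x -> X y ->
       co (fun t => c * x t + y t) n = c * co x n + co y n) &
    (forall x, X x -> forall eps : R, 0 < eps -> exists N0, forall N, (N0 <= N)%N ->
       forall t, `|x t - \sum_(n < N) co x n * e n t| <= eps)].
Proof.
move=> AX sX bX; have [XCC _ _ _] := sX.
have [e [K0 [co [[Xe e2] K01 eK0 colin xco]]]] := normalized_basis sX bX.
have K30 : 0 <= 3 * K0 by lra.
(* Perturbing a sequence of constant [K0] may triple it, and the code needs an integer constant. The
   dense functions are then taken within half of the radius allowed for [K], which makes the strict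
   inequality of the code hold. *)
pose K := Num.bound (3 * K0).
have K3 : 3 * K0 < K%:R := archi_boundP K30.
have eps_gt0 n : 0 < (2^-1 : R) ^+ n / (4 * K%:R) / 2.
  by rewrite !divr_gt0 ?half_pow_gt0//; lra.
have /choice[i iP] : forall n, exists j, forall t,
    `|e n t - D j t| < 2^-1 ^+ n / (4 * K%:R) / 2.
  by move=> n; apply: dense_funP => //; exact: XCC.
have close n t : `|D (i n) t - e n t| <= 2^-1 ^+ n / (4 * K0).
  rewrite distrC; apply: (le_trans (ltW (iP n t))).
  have := half_pow_gt0 R n; set h := _ ^+ n => h0.
  apply: (@le_trans _ _ (h / (4 * K%:R))).
    by have : 0 < h / (4 * K%:R); [rewrite divr_gt0//; lra|lra].
  by rewrite ler_pM2l// lef_pV2 ?posrE; lra.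
have e1 n : exists t, 1 <= `|e n t|.
  by have [t tP] := e2 n; exists t; lra.
have K00 : 0 < K0 by lra.
have iK : unc_const K%:R (D \o i).
  apply: unc_const_le (ltW K3) _.
  by apply: (perturb_unc K00 _ e1 eK0 close) => n; exact: XCC.
have K_gt0 : 0 < K%:R :> R by lra.
exists i, K%:R, K0, e, co; split=> //.
exists K; split=> //.
  move=> n; have [t tP] := e2 n; exists t.
  have h1 := @half_pow_le R 0 n isT; rewrite expr0 in h1.
  have : (2^-1 : R) ^+ n / (4 * K0) <= 1 by rewrite ler_pdivrMr; lra.
  have := close n t; have := ler_normB (D (i n) t) (D (i n) t - e n t).
  by rewrite opprB addrCA subrr addr0; lra.
exists X => // n; exists (e n) => //; apply: supnorm_lt => [t|].
  exact: ltW (iP n t).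
by have := eps_gt0 n; lra.
Qed.

End Coding.

(** * The tree amalgam *)

Section Tree.
Variables (R : realType) (A : set (set (fn R))).
Variable Z : (nat -> nat) -> (nat -> nat) -> Prop.
Hypothesis cZ : closed2 Z.
Hypothesis ZP : forall i, codes_basis A i <-> exists rho, Z i rho.
Hypothesis Agood : A `<=` unc_no_l1 (R:=R).
Let D := @dense_fun R.

(* Finite sequences [s] enumerate the nodes; a node is good when it is a
   nonempty initial segment of a point of [Z]. Bad nodes are isolated and carry
   the constant [1]. *)
Definition node (n : nat) : seq (nat * nat) := odflt [::] (pickle_inv n).

Definition segment (i rho : nat -> nat) l := mkseq (fun k => (i k, rho k)) l.

Definition good n := `[< exists l i rho,
  Z i rho /\ pickle_inv n = Some (segment i rho l.+1) >].

Definition node_fun n : fn R :=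
  if good n then D (last (0, 0)%N (node n)).1 else (fun=> 1).

Definition comparable m n := (m == n) || [&& good m, good n &
  prefix (node m) (node n) || prefix (node n) (node m)].

Let CC_node_fun n : CC (node_fun n).
Proof.
rewrite /node_fun; case: ifP => _; first exact: CC_dense_fun.
by apply: CC_of => e e0; exists 0%N => *; rewrite subrr normr0 ltW.
Qed.

(** Since [pickle_inv] is an exact partial inverse, a good node is the code of its segment, hence is
    determined by it. *)
Lemma goodP n : good n -> exists l i rho, [/\ Z i rho, node n = segment i rho l.+1,
  node_fun n = D (i l) & n = pickle (segment i rho l.+1)].
Proof.
move=> gn; move: (gn) => /asboolP[l [i [rho [Zi nE]]]].
exists l, i, rho.
have nodeE : node n = segment i rho l.+1 by rewrite /node nE.
split=> //.
- by rewrite /node_fun gn nodeE /segment mkseqS last_rcons.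
- by have := @pickle_invK (seq (nat * nat)) n; rewrite nE.
Qed.

Lemma segment_good i rho l : Z i rho -> good (pickle (segment i rho l.+1)) /\
  node (pickle (segment i rho l.+1)) = segment i rho l.+1.
Proof.
move=> Zi; rewrite /node pickleK_inv; split=> //.
by apply/asboolP; exists l, i, rho; rewrite pickleK_inv.
Qed.

Let node_fun_nz n : exists t, node_fun n t != 0.
Proof.
case: (boolP (good n)) => [|/negbTE gn]; last first.
  by exists point; rewrite /node_fun gn oner_eq0.
move=> /goodP[l [i [rho [Zi _ -> _]]]].
have [K [_ _ + _]] : codes_basis A i by apply/ZP; exists rho.
by move=> /(_ l)[t tP]; exists t; rewrite -normr_gt0; apply: lt_le_trans tP.
Qed.

Let comparable_refl n : comparable n n.
Proof. by rewrite /comparable eqxx. Qed.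

Let comparable_sym m n : comparable m n = comparable n m.
Proof.
by rewrite /comparable eq_sym orbC [RHS]orbC andbCA [X in _ && (_ && X)]orbC.
Qed.

(** An infinite clique is a chain of segments of unbounded length. Their union has every finite part
    extendable in [Z], so closedness of [Z] makes it a branch. The index [lev] is the length minus
    one, since the function at a node is read off its last entry. *)
Lemma infinite_clique_branch (q : pred nat) (x : nat -> nat) :
  {in q &, forall m n, comparable m n} -> (forall k, q (x k)) -> injective x ->
  exists i rho lev, [/\ Z i rho, {in q &, injective lev} &
    forall n, q n -> node_fun n = D (i (lev n))].
Proof.
move=> qc qx xinj.
(* Bad nodes are comparable only to themselves, and the clique has other members. *)
have qg n : q n -> good n.
  move=> qn; have [m [qm mn]] : exists m, q m /\ m != n.
    have [E|E] := eqVneq (x 0%N) n; last by exists (x 0%N).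
    by exists (x 1%N); split=> //; rewrite -E (inj_eq xinj).
  by have := qc m n qm qn; rewrite /comparable (negbTE mn) => /and3P[].
have nodeK m n : good m -> good n -> node m = node n -> m = n.
  move=> /goodP[l [i [rho [_ E1 _ mE]]]] /goodP[l' [i' [rho' [_ E2 _ nE]]]] E.
  by rewrite mE nE; congr pickle; rewrite -E1 -E2.
have pfx m n : q m -> q n ->
    prefix (node m) (node n) || prefix (node n) (node m).
  move=> qm qn; have := qc m n qm qn; rewrite /comparable; case: (eqVneq m n) => [->|mn] /=.
    by rewrite prefix_refl.
  by move=> /and3P[].
have nthE m n k : q m -> q n -> (k < size (node m))%N -> (k < size (node n))%N ->
    nth (0, 0)%N (node m) k = nth (0, 0)%N (node n) k.
  move=> qm qn km kn; case/orP: (pfx m n qm qn) => /prefixP[s E].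
    by rewrite E nth_cat km.
  by rewrite E nth_cat kn.
have sizeK m n : q m -> q n -> size (node m) = size (node n) -> m = n.
  move=> qm qn mn; apply: nodeK; [exact: qg|exact: qg|].
  apply: (@eq_from_nth _ (0, 0)%N) => // k km; apply: nthE => //.
  by rewrite -mn.
have /choice[b bP] : forall L, exists n, q n /\ (L < size (node n))%N.
  move=> L; apply: contrapT => H.
  have xL k : (size (node (x k)) < L.+1)%N.
    by rewrite ltnS leqNgt; apply/negP => kL; apply: H; exists (x k).
  (* Pigeonhole: in a chain the length determines the node, so [L.+2] distinct nodes cannot all have
     length at most [L]. *)
  have : (size [seq size (node (x k)) | k <- iota 0 L.+2] <= size (iota 0 L.+1))%N.
    apply: uniq_leq_size.
      rewrite map_inj_uniq ?iota_uniq// => k k' E.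
      by apply: xinj; apply: sizeK.
    by move=> _ /mapP[k _ ->]; rewrite mem_iota add0n xL.
  by rewrite size_map !size_iota ltnn.
pose sg k := nth (0, 0)%N (node (b k)) k.
pose i k := (sg k).1; pose rho k := (sg k).2.
have nodeE n : q n -> node n = segment i rho (size (node n)).
  move=> qn; apply: (@eq_from_nth _ (0, 0)%N); first by rewrite size_mkseq.
  move=> k kn; rewrite nth_mkseq// -surjective_pairing.
  by apply: nthE => //; case: (bP k).
have size_gt0 n : q n -> (0 < size (node n))%N.
  by move=> /qg/goodP[l [i' [rho' [_ -> _ _]]]]; rewrite size_mkseq.
exists i, rho, (fun n => (size (node n)).-1); split.
- apply: cZ => L; have [qb Lb] := bP L.
  have [l [i' [rho' [Zi E _ _]]]] := goodP (qg _ qb).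
  have seg k : (k < L)%N -> (i k, rho k) = (i' k, rho' k).
    move=> kL; have kb := ltn_trans kL Lb.
    have := congr1 (fun s => nth (0, 0)%N s k) (nodeE _ qb).
    rewrite nth_mkseq// => <-; rewrite E nth_mkseq//.
    by rewrite E size_mkseq in kb.
  by exists i', rho'; split=> // k /seg[].
- move=> m n qm qn; have := size_gt0 m qm; have := size_gt0 n qn => ? ? E.
  by apply: sizeK => //; lia.
- move=> n qn; have s0 := size_gt0 n qn.
  rewrite /node_fun qg// {1}nodeE//.
  by case: (size (node n)) s0 => // l _; rewrite /segment mkseqS last_rcons.
Qed.

Lemma tree_amalgam (dt : nat -> cantor_space) :
  (forall n, node_fun n (dt n) != 0) ->
  unc_no_l1 (amalgam node_fun dt comparable) /\
  forall X, A X -> embeds X (amalgam node_fun dt comparable).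
Proof.
move=> dt0.
have sY := amalgam_subspace dt0 comparable_refl comparable_sym.
split=> [|X AX].
  split=> //; first exact: (amalgam_basis CC_node_fun dt0 comparable_refl comparable_sym).
  move=> /(amalgam_l1 CC_node_fun dt0 comparable_refl comparable_sym).
  move=> [q [S [kap [v [c [C [t [[c0 C0] qc SP SC Sc]]]]]]]].
  have Sne k : exists n, n \in S k.
    apply: contrapT => /forallNP H; have := Sc k.
    by rewrite big_seq big1 ?leNgt ?c0// => n /H.
  have [x xP] := choice Sne.
  have xinj : injective x.
    move=> k k' E; have [_ /(_ _ (xP k))[_ <-]] := SP k.
    by have [_ /(_ _ (xP k'))[_ <-]] := SP k'; rewrite E.
  have qx k : q (x k) by have [_ /(_ _ (xP k))[]] := SP k.
  have [i [rho [lev [Zi levI dE]]]] := infinite_clique_branch qc qx xinj.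
  have [K [K0 iK i1 [X AX XP]]] : codes_basis A i by apply/ZP; exists rho.
  have [sX _ nl1] := Agood AX; apply: nl1.
  have [XCC X0 Xlin _] := sX.
  (* The code only says that [X] meets small balls around the [D (i n)]; picking points there moves
     the branch into [X] up to a perturbation. *)
  have /choice[e eP] : forall n, exists e, X e /\
      forall t, `|e t - D (i n) t| <= 2^-1 ^+ n / (4 * K%:R).
    move=> n; have [e Xe /ltW en] := XP n; exists e; split=> // s.
    apply: le_trans en; apply: (@supnorm_ub _ (fun t => e t - D (i n) t)).
    by apply: CCB; [exact: XCC|exact: CC_dense_fun].
  have Xe n : X (e n) by case: (eP n).
  have K0' : 0 < K%:R :> R by rewrite ltr0n.
  have pert := perturb K0' (fun n => @CC_dense_fun R (i n)) i1 iK (fun n => (eP n).2).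
  (* A left inverse of [lev] on [q], turning coefficients indexed by nodes into coefficients indexed
     by levels. *)
  have /choice[inv invP] : forall l, exists n, forall m, q m -> lev m = l -> n = m.
    move=> l; have [[n [qn nl]]|H] := pselect (exists n, q n /\ lev n = l).
      by exists n => m qm ml; apply: levI => //; rewrite nl.
    by exists 0%N => m qm ml; exfalso; apply: H; exists m.
  have sumE (k : nat -> fn R) (s : seq nat) (y : nat -> R) u : all q s ->
      \sum_(n <- s) y n * k (lev n) u = \sum_(l <- map lev s) y (inv l) * k l u.
    move=> /allP sq; rewrite big_map big_seq [RHS]big_seq.
    by apply: eq_bigr => n ns; rewrite (invP _ n)//; exact: sq.
  have ulev s : uniq s -> all q s -> uniq (map lev s).
    move=> us /allP sq; rewrite map_inj_in_uniq// => m n ms ns.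
    by apply: levI; exact: sq.
  have up s y M : uniq s -> all q s ->
      (forall u, `|\sum_(n <- s) y n * node_fun n u| <= M) ->
      forall u, `|\sum_(n <- s) y n * e (lev n) u| <= 3 / 2 * M.
    move=> us sq sM u; rewrite (sumE e)//.
    apply: (pert (map lev s) (y \o inv) M (ulev s us sq)).1 => w.
    have := sM w; rewrite -(sumE (fun l => D (i l)))//.
    rewrite big_seq [X in _ -> `|X| <= _]big_seq.
    by under eq_bigr => n ns do rewrite dE ?(allP sq)//.
  (* Passing from [e] to the dense functions costs 2, and summing absolute values at a point costs
     [2 * K]. *)
  have down s y M : uniq s -> all q s ->
      (forall u, `|\sum_(n <- s) y n * e (lev n) u| <= M) ->
      forall u, \sum_(n <- s) `|y n * node_fun n u| <= 4 * K%:R * M.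
    move=> us sq sM u.
    have H : forall w, `|\sum_(l <- map lev s) y (inv l) * D (i l) w| <= 2 * M.
      apply: (pert (map lev s) (y \o inv) M (ulev s us sq)).2 => w.
      by have := sM w; rewrite (sumE e).
    have := unc_const_abs u iK (ulev s us sq) H.
    rewrite big_map big_seq => H'.
    rewrite big_seq (_ : 4 * _ * M = 2 * K%:R * (2 * M)); last by ring.
    apply: le_trans H'; rewrite le_eqVlt; apply/orP; left; apply/eqP.
    by apply: eq_bigr => n ns; rewrite /= (invP _ n) ?dE// (allP sq).
  have Sq k : all q (S k) by apply/allP => n nS; have [_ /(_ n nS)[]] := SP k.
  have Su k : uniq (S k) by case: (SP k).
  pose u k : fn R := fun t => \sum_(n <- S k) v n * e (lev n) t.
  have Xsum s : X (fun t => \sum_(n <- s) v n * e (lev n) t).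
    elim: s => [|n s IH]; first by under eq_fun do rewrite big_nil.
    by under eq_fun do rewrite big_cons; exact: Xlin.
  have uX k : X (u k) by exact: Xsum.
  apply: (@l1_seq_contains R X u (c / (4 * K%:R)) (3 / 2 * C) sX) => //.
  - by rewrite divr_gt0//; lra.
  - by rewrite mulr_ge0//; lra.
  move=> N a; split=> [w|].
    rewrite mulr_sumr (le_trans (ler_norm_sum _ _ _))//.
    apply: ler_sum => k _; rewrite normrM mulrC; apply: ler_wpM2r => //.
    exact: (up (S k) v C (Su k) (Sq k) (SC k)).
  (* A combination of the [u k] is one sum over the disjoint union of the blocks, with coefficient
     [a (kap n) * v n] at [n]. *)
  pose fl := flatten [seq S k | k <- iota 0 N].
  have flk n : n \in fl -> q n /\ (kap n < N)%N.
    move=> /flattenP[s /mapP[k + ->] nk]; rewrite mem_iota => /andP[_ kN].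
    by have [_ /(_ n nk)[qn ->]] := SP k.
  have flu M : uniq (flatten [seq S k | k <- iota 0 M]).
    elim: M => // M IH.
    rewrite -addn1 iotaD map_cat flatten_cat cat_uniq IH /= cats0 add0n Su andbT.
    apply/hasPn => n nM; apply/negP => /flattenP[s /mapP[k + ->] nk].
    rewrite mem_iota => /andP[_ kM].
    have [_ /(_ n nk)[_ E]] := SP k; have [_ /(_ n nM)[_ E']] := SP M.
    by move: kM; rewrite -E E' ltnn.
  have flq : all q fl by apply/allP => n /flk[].
  have flE (F : nat -> R -> R -> R) :
      \sum_(n <- fl) F n (a (kap n)) (v n) = \sum_(k < N) \sum_(n <- S k) F n (a k) (v n).
    rewrite /fl big_flatten big_map -(big_mkord xpredT
      (fun k => \sum_(n <- S k) F n (a k) (v n))) /index_iota subn0.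
    apply: eq_bigr => k _; rewrite big_seq [RHS]big_seq.
    by apply: eq_bigr => n nk; have [_ /(_ n nk)[_ ->]] := SP k.
  have CU : CC (fun t => \sum_(k < N) a k * u k t).
    by apply: CC_sum => k _; apply: CCZ; exact: XCC.
  (* The norm of the combination is attained at [w]. By [down] it controls the sum of absolute
     values at the fixed point [t], where block [k] contributes at least [c] times the modulus of
     [a k]. *)
  have [w wP] := CC_attain (CC_norm CU).
  exists w; rewrite mulrAC ler_pdivrMr; last lra.
  have := down fl (fun n => a (kap n) * v n) _ (flu N) flq.
  move=> /(_ `|\sum_(k < N) a k * u k w|) H.
  have {}H := H _ t; rewrite [leRHS]mulrC; apply: le_trans (H _); last first.
    move=> s; apply: le_trans (wP s).
    rewrite (flE (fun n a v => a * v * e (lev n) s)).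
    rewrite le_eqVlt; apply/orP; left; apply/eqP; congr (`|_|).
    apply: eq_bigr => k _; rewrite /u mulr_sumr.
    by apply: eq_bigr => n _; rewrite mulrA.
  rewrite (flE (fun n a v => `|a * v * node_fun n t|)) mulr_sumr.
  apply: ler_sum => k _.
  under eq_bigr do rewrite -mulrA normrM.
  by rewrite -mulr_sumr mulrC; apply: ler_wpM2l.
have [sX bX _] := Agood AX; have [XCC _ _ _] := sX.
have [i [K [K0 [e [co [ib [K0gt K1 eK0 iK close] [Xe e1] colin xco]]]]]] :=
  basis_codes AX sX bX.
have [rho Zi] := (ZP i).1 ib.
pose nd l := pickle (segment i rho l.+1).
have ndE l : node_fun (nd l) = D (i l).
  have [g nE] := segment_good l Zi.
  by rewrite /node_fun g nE /segment mkseqS last_rcons.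
have nd_inj : injective nd.
  move=> l l' /(pcan_inj pickleK)/(congr1 size).
  by rewrite !size_mkseq => -[].
have ndc l l' : comparable (nd l) (nd l').
  wlog ll : l l' / (l <= l')%N.
    move=> H; case: (leqP l l') => [|/ltnW]; first exact: H.
    by rewrite comparable_sym; exact: H.
  have [g nE] := segment_good l Zi; have [g' nE'] := segment_good l' Zi.
  rewrite /comparable /nd g g' nE nE'.
  apply/orP; right; apply/orP; left; apply/prefixP.
  exists (map (fun k => (i k, rho k)) (iota l.+1 (l'.+1 - l.+1))).
  have := iotaD 0 l.+1 (l'.+1 - l.+1); rewrite subnKC// add0n => E.
  by rewrite /segment /mkseq E map_cat.
have pert := perturb K0gt (fun n => XCC _ (Xe n)) e1 eK0 close.
have hY n : amalgam node_fun dt comparable (amalg node_fun comparable (nd n)).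
  exact: amalgam_amalg.
(* At any point only the nodes of its clique survive: the projection costs [K], and the change from
   [e] to the dense functions costs 3/2. The reverse estimate pays only the change back, 2. *)
apply: (equivalent_basis_embeds (e := e) (B := K * (3 / 2)) (B' := 2) sX sY _ _ Xe hY colin xco) => //.
  by rewrite mulr_gt0//; lra.
move=> s a M us; split=> sM.
  move=> tau.
  have -> : \sum_(l <- s) a l * amalg node_fun comparable (nd l) tau =
      \sum_(l <- s | clique comparable tau (nd l)) a l * D (i l) (odds tau).
    rewrite [RHS]big_mkcond; apply: eq_bigr => l _.
    by rewrite /amalg ndE; case: ifP; rewrite ?mulr0.
  rewrite -mulrA; apply: (iK s (fun l => clique comparable tau (nd l))) => //.
  exact: (pert s a M us).1.
apply: (pert s a M us).2 => t.
(* The nodes of [s] lie on one branch and form a clique, so at this point the whole sum of the dense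
   functions at [t] is visible. *)
pose tau := merge (fun n => n \in map nd s) t.
have clE : clique comparable tau =1 (fun n => n \in map nd s).
  by apply: clique_merge => _ _ /mapP[l _ ->] /mapP[l' _ ->].
have := sM tau; congr (`|_| <= _).
rewrite big_seq [RHS]big_seq; apply: eq_bigr => l ls.
by rewrite /amalg clE map_f// ndE odds_merge.
Qed.

Lemma tree_universal : exists Y, unc_no_l1 Y /\ forall X, A X -> embeds X Y.
Proof.
have [dt dtP] := choice node_fun_nz.
by exists (amalgam node_fun dt comparable); exact: tree_amalgam.
Qed.

End Tree.

Theorem theorem4p1 (R : realType) (A : set (set (fn R))) :
  analytic_SB A -> A `<=` unc_no_l1 (R:=R) ->
  exists Y, unc_no_l1 Y /\ forall X, A X -> embeds X Y.
Proof.
move=> /codes_basis_suslin[Z [cZ ZP]] Agood.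
exact: tree_universal cZ ZP Agood.
Qed.
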